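(* Let $G$ be a graph with $\alpha(G)=2$, and let $n=|V(G)|$. Then $G$ contains $K_{\lceil n/2\rceil}$ as an odd minor, or $G$ contains $K_{\lceil n/2\rceil}$ as a totally odd immersion.
   Context: All graphs are finite and simple (no loops, no parallel edges). $\alpha(G)$ denotes the independence number of $G$, i.e. the maximum size of a set of pairwise non-adjacent vertices, and $K_t$ is the complete graph on $t$ vertices. The length of a path is its number of edges. Odd minor: $G$ contains $K_t$ as an odd minor if there exist pairwise vertex-disjoint subgraphs $T_1,\dots,T_t$ of $G$, each of which is a (nonempty) tree, and a colouring of the vertices of $T_1\cup\dots\cup T_t$ with two colours such that (a) every edge of every tree $T_i$ has endpoints of different colours, and (b) for all $1\le i<j\le t$ there is an edge of $G$ with one endpoint in $T_i$ and the other in $T_j$ whose two endpoints have the same colour. Immersion: $G$ contains a graph $H$ as an immersion if there exists a one-to-one mapping $\varphi\colon V(H)\to V(G)$ such that: (I) for every $uv\in E(H)$ there is a path in $G$, denoted $P_{uv}$, with endpoints $\varphi(u)$ and $\varphi(v)$; (II) the paths in $\{P_{uv}\mid uv\in E(H)\}$ are pairwise edge-disjoint; (III) the vertices of $\varphi(V(H))$ (called terminals) do not appear as internal vertices of the paths $P_{uv}$. $G$ contains $H$ as a totally odd immersion if $G$ contains $H$ as an immersion where all the corresponding paths $P_{uv}$ have odd length. *)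

(* Defs.v *)
From mathcomp Require Import all_boot.

Set Implicit Arguments.
Unset Strict Implicit.
Unset Printing Implicit Defensive.

Record sgraph := SGraph {
  vertex :> finType;
  adj : rel vertex;
  adj_sym : symmetric adj;
  adj_irrefl : irreflexive adj
}.

Definition edges (G : sgraph) : {set {set G}} :=
  [set A | [exists x, exists y, adj x y && (A == [set x; y])]].

Lemma complete_adj_sym (t : nat) : symmetric (fun i j : 'I_t => i != j).
Proof. by move=> i j; rewrite eq_sym. Qed.

Lemma complete_adj_irrefl (t : nat) : irreflexive (fun i j : 'I_t => i != j).
Proof. by move=> i; rewrite eqxx. Qed.

Definition complete (t : nat) : sgraph :=
  SGraph (@complete_adj_sym t) (@complete_adj_irrefl t).

Definition independent (G : sgraph) (A : {set G}) : bool :=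
  [forall x in A, forall y in A, ~~ adj x y].

Definition alpha (G : sgraph) : nat :=
  \max_(A : {set G} | independent A) #|A|.

Record subgraph (G : sgraph) := Subgraph {
  sub_vertices : {set G};
  sub_edges : {set {set G}};
  sub_edges_edges : sub_edges \subset edges G;
  sub_edges_vertices : sub_edges \subset powerset sub_vertices
}.

Definition sub_adj (G : sgraph) (T : subgraph G) : rel G :=
  fun x y => [set x; y] \in sub_edges T.

Definition sub_connected (G : sgraph) (T : subgraph G) : Prop :=
  {in sub_vertices T &, forall x y, connect (sub_adj T) x y}.

(* The lower bound on the size excludes x, y, x, which is a ucycle in the
   sense of the path library but not a cycle of a simple graph. *)
Definition sub_acyclic (G : sgraph) (T : subgraph G) : Prop :=
  forall c : seq G, 2 < size c -> ~ ucycle (sub_adj T) c.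

Definition is_tree (G : sgraph) (T : subgraph G) : Prop :=
  [/\ sub_vertices T != set0, sub_connected T & sub_acyclic T].

(* The values of col outside the trees are irrelevant. *)
Definition has_odd_clique_minor (G : sgraph) (t : nat) : Prop :=
  exists (T : 'I_t -> subgraph G) (col : G -> bool),
    [/\ forall i, is_tree (T i),
        forall i j, i != j ->
          [disjoint sub_vertices (T i) & sub_vertices (T j)],
        forall i x y, sub_adj (T i) x y -> col x != col y
      & forall i j : 'I_t, i < j ->
          exists x y : G, [/\ x \in sub_vertices (T i),
            y \in sub_vertices (T j), adj x y & col x = col y]].

(* A path is the sequence of its vertices. *)
Definition is_path (G : sgraph) (s : seq G) : bool :=
  [&& s != [::], sorted (@adj G) s & uniq s].

Definition path_length (G : sgraph) (s : seq G) : nat := (size s).-1.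

Definition path_ends (G : sgraph) (s : seq G) : {set G} :=
  if s is x :: p then [set x; last x p] else set0.

Definition path_internal (G : sgraph) (s : seq G) : seq G :=
  if s is x :: p then behead (belast x p) else [::].

Definition path_edges (G : sgraph) (s : seq G) : {set {set G}} :=
  [set [set a.1; a.2] | a in zip s (behead s)].

(* P is indexed by edges, as unordered pairs, so each edge of H has a single
   path; only the values of P on edges H matter. *)
Definition is_immersion (H G : sgraph) (phi : H -> G) (P : {set H} -> seq G)
    : Prop :=
  [/\ injective phi,
      {in edges H, forall A, is_path (P A) /\ path_ends (P A) = phi @: A},
      {in edges H &, forall A B, A != B ->
        [disjoint path_edges (P A) & path_edges (P B)]}
    & {in edges H, forall A (u : H), phi u \notin path_internal (P A)}].

Definition has_totally_odd_immersion (H G : sgraph) : Prop :=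
  exists (phi : H -> G) (P : {set H} -> seq G),
    is_immersion phi P /\ {in edges H, forall A, odd (path_length (P A))}.

(* Main.v *)
Require Import Defs.
From mathcomp Require Import all_boot.
From mathcomp Require Import zify.

Set Implicit Arguments.
Unset Strict Implicit.
Unset Printing Implicit Defensive.

(** Let H be the complement of G, which is triangle-free, let n = |G| and
    m = uphalf n, and let K be a maximum clique of G, of size k.

    If k is small, then so are all the degrees in H, as neighbourhoods in H are
    cliques of G. Fix a maximum matching of H and a set T of m terminals that
    contains one end of each matching edge and half of the unmatched vertices.
    Two terminals u, v that are not adjacent in G have partners u', v', and unless
    u'v' is in H as well, u v' u' v is a path of G. In the remaining case,
    we link by u w u' v for a common neighbour w of u and u' outside T; by the
    degree bound and the minimality of the number of such cases there are enough
    such w, and Hall's theorem makes the resulting paths edge-disjoint.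

    If k is large, we look for m - k disjoint seagulls (induced paths on three
    vertices) outside K: the ends of a seagull dominate every other vertex,
    so K and the seagulls form an odd minor. By maximality of K, anticomplete
    cliques P and Q outside K satisfy |P| + |Q| <= k, because each vertex of K is
    complete to P or to Q. The existence of the seagulls follows from this by
    exchange arguments, applied to a packing that is one seagull short and to the
    two anticomplete cliques it leaves uncovered (compare Chudnovsky and Seymour,
    Packing seagulls). *)

(** Compares counts under an arbitrary predicate: on explicit lists these are sums of booleans, and
    with the booleans generalized to naturals a linear identity is left. *)
Ltac perm_atoms := apply/permP => ? /=;
  repeat match goal with |- context [nat_of_bool ?h] => generalize (nat_of_bool h) end;
  clear; lia.

(** * Finite sets *)

Lemma card_gt1_neq (A : finType) (P : {set A}) p : 1 < #|P| -> exists2 p', p' \in P & p' != p.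
Proof.
case/card_gt1P => p1 [p2 [p1P p2P p12]].
by have [E|] := eqVneq p1 p; [exists p2; rewrite // -E eq_sym | exists p1].
Qed.

Lemma subset_of_card (T : finType) (A : {set T}) n :
  n <= #|A| -> exists2 B : {set T}, B \subset A & #|B| = n.
Proof.
move=> nA; exists [set x in take n (enum A)].
  by apply/subsetP => x; rewrite inE => /mem_take; rewrite mem_enum.
by rewrite cardsE (card_uniqP _) ?take_uniq ?enum_uniq // size_takel -?cardE.
Qed.

Lemma card_fibers (A B : finType) (h : A -> B) (X : {set A}) (Y : {set B}) :
  {in X, forall a, h a \in Y} -> #|X| = \sum_(b in Y) #|[set a in X | h a == b]|.
Proof.
move=> XY; rewrite -sum1_card (partition_big h (mem Y)) //=.
by apply: eq_bigr => b _; rewrite -sum1_card; apply: eq_bigl => a; rewrite inE.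
Qed.

Lemma card_pairs (A B : finType) (P : A -> B -> bool) :
  #|[set p : A * B | P p.1 p.2]| = \sum_a #|[set b | P a b]|.
Proof.
rewrite -sum1_card; under [RHS]eq_bigr => a _ do rewrite -sum1_card.
by rewrite pair_big_dep; apply: eq_bigl => p; rewrite !inE.
Qed.

Lemma set2_eq (A : finType) (a b c d : A) : [set a; b] = [set c; d] ->
  a = c /\ b = d \/ a = d /\ b = c.
Proof.
move=> E; have := set21 a b; have := set22 a b; rewrite E !inE.
move=> /orP[]/eqP bE /orP[]/eqP aE; subst a b; auto.
- by have := set22 c d; rewrite -E !inE => /orP[]/eqP->; auto.
- by have := set21 c d; rewrite -E !inE => /orP[]/eqP->; auto.
Qed.

(** Induction on [#|D|]. A tight proper subset [X], with exactly [#|X|] neighbours, is matched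
    first, and Hall's condition survives on [D :\: X] once these neighbours are deleted. If no
    nonempty proper subset is tight, one element may take any of its neighbours. [b0] supplies a
    function when [D] is empty. *)
Theorem hall (A B : finType) (b0 : B) (r : A -> {set B}) (D : {set A}) :
  (forall X : {set A}, X \subset D -> #|X| <= #|\bigcup_(a in X) r a|) ->
  exists2 f : A -> B, {in D &, injective f} & {in D, forall a, f a \in r a}.
Proof.
have [n] := ubnP #|D|; elim: n r D => // n IH r D Dn hallD.
have [->|/set0Pn[a0 a0D]] := eqVneq D set0.
  by exists (fun=> b0) => a; rewrite inE.
have cupS (X Y : {set A}) : X \subset Y -> \bigcup_(a in X) r a \subset \bigcup_(a in Y) r a.
  by move=> /subsetP XY; apply/bigcupsP => a aX; apply: (bigcup_max a); rewrite ?XY.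
case: (boolP [exists X : {set A}, [&& X \proper D, X != set0 &
    #|\bigcup_(a in X) r a| == #|X|]]) => [/existsP[X /and3P[XD X0 /eqP cX]]|slack].
  have XsD := proper_sub XD.
  have [||f fi fr] := IH r X.
  - by rewrite -ltnS (leq_trans _ Dn) // ltnS proper_card.
  - by move=> Y YX; apply: hallD; apply: subset_trans XsD.
  set N := \bigcup_(a in X) r a.
  have [||g gi gr] := IH (fun a => r a :\: N) (D :\: X).
  - have X1 : 0 < #|X| by rewrite card_gt0.
    by move: Dn; rewrite -(cardsID X D) (setIidPr XsD); move: X1; clear; lia.
  - move=> Y; rewrite subsetD => /andP[YD YX].
    have -> : \bigcup_(a in Y) (r a :\: N) = (\bigcup_(a in Y :|: X) r a) :\: N.
      rewrite bigcup_setU setDUl -/N setDv setU0.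
      apply/setP => b; rewrite in_setD; apply/bigcupP/andP.
        by case=> a aY; rewrite inE => /andP[bN br]; split=> //; apply/bigcupP; exists a.
      by case=> bN /bigcupP[a aY br]; exists a; rewrite // inE bN.
    have NS : N \subset \bigcup_(a in Y :|: X) r a by apply: cupS; apply: subsetUr.
    have := hallD (Y :|: X); rewrite subUset YD XsD => /(_ isT).
    rewrite cardsDS // -/N in cX * => h.
    move: YX; rewrite -(leq_card_setU Y X) => /eqP E; rewrite E in h.
    by move: h; rewrite /N cX; clear; lia.
  have fN a : a \in X -> f a \in N by move=> aX; apply/bigcupP; exists a; rewrite ?fr.
  exists (fun a => if a \in X then f a else g a) => [a a' aD a'D|a aD].
    have gN c : c \in D -> c \notin X -> g c \notin N.
      by move=> cD cX'; have := gr c; rewrite !inE cD cX' => /(_ isT)/andP[].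
    case: ifPn => aX; case: ifPn => a'X E.
    + exact: fi.
    + by have := gN a' a'D a'X; rewrite -E fN.
    + by have := gN a aD aX; rewrite E fN.
    + by apply: gi; rewrite // inE ?aX ?a'X.
  case: ifPn => aX; first exact: fr.
  by have := gr a; rewrite inE aX aD => /(_ isT); rewrite inE => /andP[].
have [b br] : exists b, b \in r a0.
  have := hallD [set a0]; rewrite sub1set a0D big_set1 cards1 => /(_ isT).
  by rewrite card_gt0 => /set0Pn.
have [||g gi gr] := IH (fun a => r a :\ b) (D :\ a0).
- by move: Dn; rewrite (cardsD1 a0 D) a0D; clear; lia.
- move=> Y YD; have [->|Y0] := eqVneq Y set0; first by rewrite cards0.
  have YpD : Y \proper D by apply: sub_proper_trans YD (properD1 a0D).
  have lt : #|Y| < #|\bigcup_(a in Y) r a|.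
    rewrite ltn_neqAle hallD ?proper_sub // andbT eq_sym.
    by apply: contra slack => h; apply/existsP; exists Y; rewrite YpD Y0.
  have -> : \bigcup_(a in Y) (r a :\ b) = (\bigcup_(a in Y) r a) :\ b.
    apply/setP => c; rewrite in_setD1; apply/bigcupP/andP.
      by case=> a aY; rewrite !inE => /andP[cb cr]; split=> //; apply/bigcupP; exists a.
    by case=> cb /bigcupP[a aY cr]; exists a; rewrite // !inE cb.
  by move: lt; rewrite (cardsD1 b (\bigcup_(a in Y) r a)); clear; case: (b \in _); lia.
have gb a : a \in D -> a != a0 -> (g a != b) && (g a \in r a).
  by move=> aD aa; have := gr a; rewrite !inE aa aD; apply.
exists (fun a => if a == a0 then b else g a) => [a a' aD a'D|a aD].
  case: eqVneq => [->|aa]; case: eqVneq => [->|a'a] // E.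
  - by have := gb a' a'D a'a; rewrite -E eqxx.
  - by have := gb a aD aa; rewrite E eqxx.
  - by apply: gi; rewrite // !inE ?aa ?a'a.
by case: eqVneq => [->|aa] //; have /andP[] := gb a aD aa.
Qed.

(** * Packing seagulls *)

Section TriangleFree.

Variables (V : finType) (e : rel V).
Hypotheses (e_sym : symmetric e) (e_irr : irreflexive e).
Hypothesis e_tri : forall x y z, e x y -> e y z -> ~~ e x z.

Implicit Types (x y z b p q u v w : V) (D J L P Q S : {set V}) (F : {set {set V}}).

Definition stable P := {in P &, forall x y, ~~ e x y}.
Definition joined P Q := {in P & Q, forall x y, e x y}.

(* [e] is adjacency in the complement of the graph of interest, in which
   [x - b - y] is thus an induced path. *)
Definition seagull x y b := [&& e x y, ~~ e x b & ~~ e y b].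
Definition seagull_set S := exists x y b, S = [set x; y; b] /\ seagull x y b.

Definition packing J F :=
  [/\ trivIset F, cover F \subset J & {in F, forall S, seagull_set S}].

Lemma neq_edge x y : e x y -> x != y.
Proof. by move=> exy; apply/eqP => E; rewrite E e_irr in exy. Qed.

Lemma seagull_uniq x y b : seagull x y b -> uniq [:: x; y; b].
Proof.
case/and3P => exy exb eyb; rewrite /= !inE negb_or neq_edge //= andbT.
apply/andP; split; apply/eqP => E.
  by rewrite -E e_sym exy in eyb.
by rewrite -E exy in exb.
Qed.

Lemma seagullC x y b : seagull x y b = seagull y x b.
Proof. by rewrite /seagull e_sym andbCA andbC -andbA andbC -!andbA; congr (_ && _); rewrite andbC. Qed.

Lemma card_seagull S : seagull_set S -> #|S| = 3.
Proof.
case=> x [y [b [-> /seagull_uniq U]]].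
have -> : [set x; y; b] = [set z in [:: x; y; b]].
  by apply/setP => z; rewrite !inE orbA.
by rewrite cardsE; apply/card_uniqP.
Qed.

Definition vertices (t : V * V * V) := [:: t.1.1; t.1.2; t.2].
Definition is_seagull (t : V * V * V) := seagull t.1.1 t.1.2 t.2.
Definition has_seagulls n J := exists2 F, packing J F & #|F| = n.

Lemma cover0 : cover (set0 : {set {set V}}) = set0.
Proof. by rewrite /cover big_set0. Qed.

Lemma coverU1 S F : cover (S |: F) = S :|: cover F.
Proof. by rewrite /cover bigcup_setU big_set1. Qed.

Lemma packing0 J : packing J set0.
Proof.
split; last by move=> S; rewrite inE.
- by apply/trivIsetP => A B; rewrite inE.
- by rewrite cover0 sub0set.
Qed.

Lemma packing_cover J F : packing J F -> #|cover F| = 3 * #|F|.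
Proof.
case=> /eqP <- _ sF; rewrite mulnC -sum_nat_const.
by apply: eq_bigr => S /sF /card_seagull.
Qed.

Lemma packing_sub J F F' : packing J F -> F' \subset F -> packing J F'.
Proof.
move=> [triv cov sF] FF; split; first exact: trivIsetS FF triv.
- apply: subset_trans cov; apply/bigcupsP => A AF.
  by apply: bigcup_sup; apply: (subsetP FF).
- by move=> A /(subsetP FF) /sF.
Qed.

Lemma packing_disjoint J F F' S v : packing J F -> S \in F -> S \notin F' ->
  F' \subset F -> v \in S -> v \notin cover F'.
Proof.
case=> /trivIsetP triv _ _ SF SF' FF vS; apply/bigcupP => -[A AF vA].
have AS : A != S by apply: contraNneq SF' => <-.
by have /pred0P/(_ v) := triv _ _ (subsetP FF _ AF) SF AS; rewrite /= vA vS.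
Qed.

Lemma packingU1 J F x y b :
  packing J F -> seagull x y b -> [set x; y; b] \subset J :\: cover F ->
  packing J ([set x; y; b] |: F) /\ #|[set x; y; b] |: F| = #|F|.+1.
Proof.
set S := [set x; y; b] => pF sg /subsetP sub; have [triv cov sF] := pF.
have Sfree v : v \in S -> (v \in J) && (v \notin cover F).
  by move/sub; rewrite inE andbC.
have SF : S \notin F.
  apply/negP => SF; have xS : x \in S by rewrite !inE eqxx.
  by have /andP[_ /bigcupP[]] := Sfree x xS; exists S.
split; last by rewrite cardsU1 SF.
split.
- apply/trivIsetP => A B; rewrite !inE => /orP[/eqP->|AF] /orP[/eqP->|BF].
  + by rewrite eqxx.
  + move=> _; apply/pred0P => v; apply/negP => /andP[/Sfree/andP[_ vF] vB].
    by case/bigcupP: vF; exists B.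
  + move=> _; apply/pred0P => v; apply/negP => /andP[vA /Sfree/andP[_ vF]].
    by case/bigcupP: vF; exists A.
  + exact: (trivIsetP triv).
- by rewrite coverU1 subUset cov andbT; apply/subsetP => v /Sfree/andP[].
- by move=> A; rewrite !inE => /orP[/eqP->|/sF //]; exists x, y, b.
Qed.

(** Listing the new seagulls as triples turns their mutual disjointness into one [uniq] condition on
    the flattened list. *)
Lemma packing_extend J F (ts : seq (V * V * V)) :
  packing J F -> all is_seagull ts -> uniq (flatten (map vertices ts)) ->
  {subset flatten (map vertices ts) <= J :\: cover F} ->
  has_seagulls (#|F| + size ts) J.
Proof.
elim: ts F => [|[[x y] b] ts IH] F pF; first by exists F => //; rewrite addn0.
case/andP=> sg sgs.
have -> : flatten (map vertices ((x, y, b) :: ts)) =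
          vertices (x, y, b) ++ flatten (map vertices ts) by [].
rewrite cat_uniq => /and3P[_ dis uts] sub.
have SE v : (v \in [set x; y; b]) = (v \in vertices (x, y, b)).
  by rewrite !inE orbA.
have [|pS cS] := @packingU1 J F x y b pF sg.
  by apply/subsetP => v; rewrite SE => vS; apply: sub; rewrite mem_cat vS.
rewrite addnS -addSn -cS; apply: IH => // v vts.
rewrite coverU1 in_setD in_setU SE negb_or.
have := sub v; rewrite mem_cat vts orbT in_setD => /(_ isT)/andP[-> ->].
by rewrite !andbT; apply: contra dis => ?; apply/hasP; exists v.
Qed.

(** * Packings that cannot be enlarged, and the vertices they leave uncovered *)

Section NoImprovement.

Variables (J : {set V}) (F : {set {set V}}).
Hypotheses (pF : packing J F) (maxF : ~ has_seagulls #|F|.+1 J).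

Lemma spareP S v : S \in F -> v \in S :|: (J :\: cover F) -> v \in J :\: cover (F :\ S).
Proof.
move=> SF; case: (pF) => _ cov _; rewrite in_setU => /orP[vS|].
  rewrite inE (packing_disjoint pF SF) ?subsetDl ?inE ?eqxx //=.
  by apply: (subsetP cov); apply/bigcupP; exists S.
rewrite !inE => /andP[vF ->]; rewrite andbT; apply: contra vF => /bigcupP[A].
by rewrite !inE => /andP[_ AF] vA; apply/bigcupP; exists A.
Qed.

(** Two disjoint seagulls made of [S] and uncovered vertices would replace [S], against [maxF]. The
    list [l] carries the distinctness of the six vertices, so each use only has to say how they
    split into two triples. *)
Lemma no_two S (l : seq V) x y b x' y' b' :
  S \in F -> uniq l -> {subset l <= S :|: (J :\: cover F)} ->
  perm_eq [:: x; y; b; x'; y'; b'] l ->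
  seagull x y b -> ~~ seagull x' y' b'.
Proof.
move=> SF ul sub perm sg; apply/negP => sg'; case: maxF.
have -> : #|F|.+1 = #|F :\ S| + 2 by rewrite (cardsD1 S F) SF addn2.
apply: (@packing_extend J (F :\ S) [:: (x, y, b); (x', y', b')]).
- exact: packing_sub pF (subsetDl _ _).
- by rewrite /= /is_seagull /= sg sg'.
- by rewrite (perm_uniq perm).
- by move=> v; rewrite (perm_mem perm) => /sub /(spareP SF).
Qed.

Lemma no_two_cat S (c s : seq V) x1 y1 b1 x2 y2 b2 :
  S \in F -> uniq c -> uniq s -> {subset c <= J :\: cover F} -> {subset s <= S} ->
  perm_eq [:: x1; y1; b1; x2; y2; b2] (c ++ s) ->
  seagull x1 y1 b1 -> ~~ seagull x2 y2 b2.
Proof.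
move=> SF uc us subc subs perm; apply: (no_two SF _ _ perm).
  rewrite cat_uniq uc us andbT andTb; apply/hasPn => v /subs vS.
  apply: contraL vS => /subc; rewrite in_setD => /andP[+ _].
  by apply: contra => vS; apply/bigcupP; exists S.
by move=> v; rewrite mem_cat in_setU orbC => /orP[/subs ->|/subc ->]; rewrite ?orbT.
Qed.

Lemma no_two_triple x y b c1 c2 c3 x1 y1 b1 x2 y2 b2 :
  [set x; y; b] \in F -> seagull x y b -> uniq [:: c1; c2; c3] ->
  {subset [:: c1; c2; c3] <= J :\: cover F} ->
  perm_eq [:: x1; y1; b1; x2; y2; b2] [:: c1; c2; c3; x; y; b] ->
  seagull x1 y1 b1 -> ~~ seagull x2 y2 b2.
Proof.
move=> SF sg uc sub; apply: (no_two_cat SF uc (seagull_uniq sg) sub).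
by move=> v; rewrite !inE -orbA.
Qed.

Lemma leftover_no_seagull x y b :
  {subset [:: x; y; b] <= J :\: cover F} -> ~~ seagull x y b.
Proof.
move=> sub; apply/negP => sg; case: maxF; rewrite -addn1.
apply: (@packing_extend J F [:: (x, y, b)]) => //.
- by rewrite /= /is_seagull sg.
- exact: (seagull_uniq sg).
Qed.

(* The vertices missed by a maximum packing induce a complete bipartite graph
   of [e] with sides [P] and [Q], as they contain no further seagull. *)
Definition leftover P Q :=
  [/\ P :|: Q = J :\: cover F, joined P Q, P != set0 & Q != set0].

Lemma leftoverC P Q : leftover P Q -> leftover Q P.
Proof.
case=> PQ jPQ P0 Q0; split=> //; first by rewrite setUC.
by move=> x y xQ yP; rewrite e_sym jPQ.
Qed.

Lemma leftover_stable P Q : leftover P Q -> stable P.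
Proof.
case=> _ jPQ _ /set0Pn[q qQ] x y xP yP.
by apply: (@e_tri _ q); [exact: jPQ | rewrite e_sym; exact: jPQ].
Qed.

(** The sides are the neighbourhoods of [u] and [v] among the uncovered vertices. A vertex in
    neither would form a seagull with [u] and [v], and a nonadjacent pair [p], [q] from opposite
    sides would make [u], [p], [q] a seagull. *)
Lemma leftover_exists u v :
  u \in J :\: cover F -> v \in J :\: cover F -> e u v ->
  exists P Q, leftover P Q.
Proof.
set L := J :\: cover F => uL vL uv.
exists [set w in L | e u w], [set w in L | e v w]; split.
- apply/setP => w; rewrite !inE -in_setD -/L -andb_orr.
  case: (boolP (w \in L)) => //= wL; apply/negPn/negP; rewrite negb_or => /andP[uw vw].
  have sub : {subset [:: u; v; w] <= L} by apply/allP; rewrite /= uL vL wL.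
  by have /negP[] := leftover_no_seagull sub; rewrite /seagull uv uw vw.
- move=> p q; rewrite !inE -!in_setD -/L => /andP[pL up] /andP[qL vq].
  apply/negPn/negP => pq.
  have uq : ~~ e u q by apply: (e_tri uv).
  have sub : {subset [:: u; p; q] <= L} by apply/allP; rewrite /= uL pL qL.
  by have /negP[] := leftover_no_seagull sub; rewrite /seagull up uq pq.
- by apply/set0Pn; exists v; rewrite inE vL.
- by apply/set0Pn; exists u; rewrite inE uL e_sym.
Qed.

Lemma count_hits (h : pred V) :
  (forall S, S \in F -> exists2 v, v \in S & h v) ->
  #|F| <= #|[set v in cover F | h v]|.
Proof.
move=> hit; have [triv _ _] := pF.
rewrite -sum1_card -[X in _ <= X]sum1_card.
under [X in _ <= X]eq_bigl => v do rewrite inE.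
rewrite big_trivIset_cond //; apply: leq_sum => S SF.
by have [v vS hv] := hit S SF; rewrite (bigD1 v) ?vS.
Qed.

(* Otherwise two disjoint seagulls could replace the seagull [x; y; b]. Three
   vertices in [P] are needed: with two, [e] may induce a pentagon plus an
   isolated vertex. *)
Lemma missed_triple a P x y b :
  leftover P [set a] -> 2 < #|P| -> [set x; y; b] \in F -> seagull x y b ->
  ~~ e a x -> ~~ e a y -> ~~ e a b ->
  {in P, forall c, e b c} /\
  ({in P, forall c, e x c} \/ {in P, forall c, e y c}).
Proof.
move=> lo P3 SF sg ax ay ab; have [PL jP _ _] := lo.
have stP := leftover_stable lo.
have [exy exb eyb] := and3P sg.
have aP p : p \in P -> e p a by move=> pP; apply: jP; rewrite ?inE.
have free c w x1 y1 b1 x2 y2 b2 : c \in P -> w \in P -> c != w ->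
    perm_eq [:: x1; y1; b1; x2; y2; b2] [:: a; c; w; x; y; b] ->
    seagull x1 y1 b1 -> ~~ seagull x2 y2 b2.
  move=> cP wP cw perm; apply: (no_two_triple SF sg _ _ perm).
    by rewrite /= !inE negb_or cw !(eq_sym a) !(neq_edge (aP _ _)).
  by apply/allP; rewrite /= -PL !inE cP wP eqxx orbT.
(* In this fact and the next three, the hypothesis makes three of the six vertices a seagull, and
   the conclusion says that the other three do not form one. *)
have xyb c w : c \in P -> w \in P -> c != w -> ~~ e x c -> e y w = e b w.
  move=> cP wP cw xc; have sg1 : seagull a c x by rewrite /seagull e_sym aP // ax e_sym.
  apply/idP/idP => [yw | bw]; apply/negPn/negP => n.
  - have /negP := @free c w a c x y w b cP wP cw ltac:(perm_atoms) sg1; apply.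
    by rewrite /seagull yw eyb e_sym.
  - have /negP := @free c w a c x b w y cP wP cw ltac:(perm_atoms) sg1; apply.
    by rewrite /seagull bw e_sym eyb e_sym.
have yxb c w : c \in P -> w \in P -> c != w -> ~~ e y c -> e x w = e b w.
  move=> cP wP cw yc; have sg1 : seagull a c y by rewrite /seagull e_sym aP // ay e_sym.
  apply/idP/idP => [xw | bw]; apply/negPn/negP => n.
  - have /negP := @free c w a c y x w b cP wP cw ltac:(perm_atoms) sg1; apply.
    by rewrite /seagull xw exb e_sym.
  - have /negP := @free c w a c y b w x cP wP cw ltac:(perm_atoms) sg1; apply.
    by rewrite /seagull bw e_sym exb e_sym.
have bxy c w : c \in P -> w \in P -> c != w -> ~~ e b c -> e x w || e y w.
  move=> cP wP cw bc; apply/negPn/negP; rewrite negb_or => /andP[xw yw].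
  have sg1 : seagull a c b by rewrite /seagull e_sym aP // ab e_sym.
  have /negP := @free c w a c b x y w cP wP cw ltac:(perm_atoms) sg1; apply.
  by rewrite /seagull exy xw.
have bb c w : c \in P -> w \in P -> c != w -> e b c -> e b w.
  move=> cP wP cw bc; apply/negPn/negP => bw.
  have sg1 : seagull x y a by rewrite /seagull exy e_sym ax e_sym.
  have /negP := @free c w x y a b c w cP wP cw ltac:(perm_atoms) sg1; apply.
  by rewrite /seagull bc bw stP.
have notxy c : ~~ (e x c && e y c).
  by apply/negP => /andP[xc yc]; move: (e_tri exy yc); rewrite xc.
have [c [w [z [[cP wP zP] [cw wz zc]]]]] := card_gt2P P3.
(* If [b] misses [c], then it misses all of [P], and adjacency to [x] or [y] passes to the other end
   at every other vertex of [P]. Going round [w], [z], [c] makes both [x] and [y] adjacent to [c],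
   which closes a triangle. *)
case: (boolP (e b c)) => bc; last first.
  have bP p : p \in P -> ~~ e b p.
    move=> pP; have [<- //|cp] := eqVneq c p; apply: contra bc => bp.
    by apply: (bb p c) => //; rewrite eq_sym.
  have := bxy c w cP wP cw bc.
  have yx p p' : p \in P -> p' \in P -> p != p' -> e y p -> e x p'.
    move=> pP p'P pp' yp; apply/negPn/negP => xp'.
    by move: (bP p pP); rewrite -(xyb p' p) // ?yp // eq_sym.
  have xy p p' : p \in P -> p' \in P -> p != p' -> e x p -> e y p'.
    move=> pP p'P pp' xp; apply/negPn/negP => yp'.
    by move: (bP p pP); rewrite -(yxb p' p) // ?xp // eq_sym.
  have wc : w != c by rewrite eq_sym.
  case/orP => h.
    have yc := xy w c wP cP wc h; have yz := xy w z wP zP wz h.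
    by have := notxy c; rewrite yc (yx z c zP cP zc yz).
  have xc := yx w c wP cP wc h; have xz := yx w z wP zP wz h.
  by have := notxy c; rewrite xc (xy z c zP cP zc xz).
have bP p : p \in P -> e b p.
  by move=> pP; have [<- //|cp] := eqVneq c p; apply: (bb c p).
split=> //.
(* If both ends missed [p], then by [xyb] and [yxb] both would be adjacent, like [b], to any other
   [p'], again a triangle. *)
have one p : p \in P -> e x p || e y p.
  move=> pP; apply/negPn/negP; rewrite negb_or => /andP[xp yp].
  have [p' p'P pp'] : exists2 p', p' \in P & p != p'.
    by have [E|] := eqVneq p c; [exists w; rewrite // E | exists c].
  have := notxy p'; rewrite (xyb p p') // (yxb p p') // bP //.
have xall p p' : p \in P -> p' \in P -> e x p -> e x p'.
  move=> pP p'P xp; have [<- //|pp'] := eqVneq p p'.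
  apply/negPn/negP => xp'; have := notxy p.
  by rewrite xp (xyb p' p) // ?bP // eq_sym.
have [xc|xc] := boolP (e x c); first by left=> p pP; apply: xall xc.
right=> p pP; have := one p pP; case: (boolP (e x p)) => //= xp.
by have := xall p c pP cP xp; rewrite (negPf xc).
Qed.

Definition full P v := [forall p in P, e v p].

Lemma fullP P v : reflect {in P, forall p, e v p} (full P v).
Proof. exact: forall_inP. Qed.

Lemma not_fullP P v : reflect (exists2 p, p \in P & ~~ e v p) (~~ full P v).
Proof. by apply: (iffP forall_inPn) => -[p ? ?]; exists p. Qed.

(* In the complement of [e], a connector has neighbours in both [P] and [Q],
   any other vertex is anticomplete to one of them. *)
Definition connector P Q v := ~~ full P v && ~~ full Q v.

(* When [u] is needed elsewhere, [q] can take its place in the seagull [S]. *)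
Definition repairable S u q :=
  exists2 t, is_seagull t & {subset vertices t <= q |: S :\ u}.

(* Releasing [u] from [S] costs a vertex on the side of [u], or any vertex of the
   other side, so that two seagulls never compete for the same leftover vertex. *)
Definition half_reduct S D P Q := forall u, u \in S :\: D -> full Q u ->
  (exists2 p, p \in P & repairable S u p) \/ {in Q, forall q, repairable S u q}.

(** Once [D] is discarded, the rest of [S] behaves like leftover vertices: each vertex falls on one
    of the two sides, opposite sides are joined within [S], and each vertex can be released at a
    controlled price. *)
Definition reduct S D P Q :=
  [/\ #|D| <= 2, half_reduct S D P Q, half_reduct S D Q P,
      {in S :\: D &, forall u v, full Q u -> full P v -> e u v} &
      {in S :\: D, forall u, full Q u || full P u}].

Lemma reductC S D P Q : reduct S D P Q -> reduct S D Q P.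
Proof.
case=> D2 h1 h2 cross tot; split=> // [u v uS vS fu fv|u uS].
  by rewrite e_sym cross.
by rewrite orbC tot.
Qed.

Lemma full_notin P Q v : leftover P Q -> full Q v -> {in P, forall p, ~~ e v p}.
Proof.
case=> _ jPQ _ /set0Pn[q qQ] /fullP fv p pP.
by apply: (@e_tri _ q); [exact: fv | rewrite e_sym; exact: jPQ].
Qed.

Lemma full_stable Q u v : Q != set0 -> full Q u -> full Q v -> ~~ e u v.
Proof.
case/set0Pn => q qQ /fullP/(_ q qQ) uq /fullP/(_ q qQ) vq.
by apply: (@e_tri _ q); rewrite // e_sym.
Qed.

Lemma full_opposite P Q x y : leftover P Q -> e x y ->
  ~~ connector P Q y -> full Q x -> full P y.
Proof.
move=> [_ _ _ Q0] xy; rewrite negb_and !negbK => /orP[//|fy] fx.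
by have := full_stable Q0 fx fy; rewrite xy.
Qed.

Lemma repairableI S u q v w : v \in S -> w \in S -> v != u -> w != u ->
  seagull q v w || seagull v w q -> repairable S u q.
Proof.
move=> vS wS vu wu /orP[]sg; [exists (q, v, w) | exists (v, w, q)] => // z;
  by rewrite !inE => /or3P[]/eqP->; rewrite ?eqxx ?vS ?wS ?vu ?wu ?orbT.
Qed.

(** The ends [x] and [y] lie on opposite sides, as they are adjacent. Releasing one of them leaves
    the other end and [b], which form a seagull with a leftover vertex missed by [b] on the side of
    the released end. *)
Lemma reduct_middle P Q x y b : leftover P Q -> seagull x y b ->
  connector P Q b -> ~~ connector P Q x -> ~~ connector P Q y ->
  reduct [set x; y; b] [set b] P Q.
Proof.
move=> lo sg cb cx cy; have [exy exb eyb] := and3P sg.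
have := seagull_uniq sg; rewrite /= !inE negb_or andbT => /andP[/andP[xy xb] yb].
have half P' Q' : leftover P' Q' -> connector P' Q' b ->
    ~~ connector P' Q' x -> ~~ connector P' Q' y ->
    half_reduct [set x; y; b] [set b] P' Q'.
  move=> lo' /andP[/not_fullP[p pP bp] _] cx' cy' u.
  rewrite !inE -orbA => /andP[ub /or3P[]/eqP E fu]; last by rewrite E eqxx in ub.
  - left; exists p => //; apply: (@repairableI _ _ _ y b); rewrite ?inE ?eqxx ?orbT ?E 1?eq_sym //.
    rewrite /seagull eyb e_sym (e_sym p b) bp (fullP _ _ (full_opposite lo' exy cy' _)) -?E //.
  - left; exists p => //; apply: (@repairableI _ _ _ x b); rewrite ?inE ?eqxx ?orbT ?E // 1?eq_sym //.
    rewrite /seagull exb e_sym (e_sym p b) bp (fullP _ _ (@full_opposite _ _ y x lo' _ cx' _)) -?E //.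
    by rewrite E e_sym.
have lo' := leftoverC lo.
have cC v : connector Q P v = connector P Q v by rewrite /connector andbC.
have [_ _ P0 Q0] := lo.
split; [by rewrite cards1 | by apply: half | by apply: half; rewrite ?cC | |].
- move=> u v; rewrite !inE -!orbA => /andP[ub] /or3P[]/eqP E /andP[vb] /or3P[]/eqP E';
    rewrite {u}E {v}E' ?eqxx in ub vb * => // fu fv; rewrite // 1?e_sym //.
  + by have := full_notin lo fu; case/set0Pn: P0 => p pP /(_ p pP); rewrite (fullP _ _ fv).
  + by have := full_notin lo fu; case/set0Pn: P0 => p pP /(_ p pP); rewrite (fullP _ _ fv).
- move=> u; rewrite !inE -!orbA => /andP[ub] /or3P[]/eqP E; rewrite {u}E ?eqxx in ub *.
  + by move: cx; rewrite negb_and !negbK orbC.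
  + by move: cy; rewrite negb_and !negbK orbC.
  + by [].
Qed.

(** By [opp], [y] and [b] lie on the same side. If this is the side of [P], then [y] is replaced by
    any [q] in [Q], through the seagull [q], [b], [x], and [b] by some [p] in [P] missed by [x],
    through [x], [y], [p]. *)
Lemma reduct_end P Q x y b : leftover P Q -> 1 < #|P| -> 1 < #|Q| ->
  [set x; y; b] \in F -> seagull x y b ->
  connector P Q x -> ~~ connector P Q y -> ~~ connector P Q b ->
  reduct [set x; y; b] [set x] P Q.
Proof.
move=> lo P1 Q1 SF sg cx cy cb; have [exy exb eyb] := and3P sg.
have := seagull_uniq sg; rewrite /= !inE negb_or andbT => /andP[/andP[xy xb] yb].
have lo' := leftoverC lo.
have cC v : connector Q P v = connector P Q v by rewrite /connector andbC.
have opp P' Q' : leftover P' Q' -> 1 < #|Q'| -> connector P' Q' x ->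
    full Q' y -> ~~ full P' b.
  move=> l Q'1 /andP[/not_fullP[p pP xp] /not_fullP[q qQ xq]] fy; apply/negP => fb.
  have [q' q'Q qq'] := card_gt1_neq q Q'1; have [PQ jPQ _ _] := l.
  have sg1 : seagull y q' b.
    by rewrite /seagull (fullP _ _ fy) // eyb e_sym (full_notin (leftoverC l) fb).
  have /negP[] : ~~ seagull p q x; last by rewrite /seagull jPQ // (e_sym p) xp (e_sym q) xq.
  apply: (@no_two_triple x y b p q q' y q' b p q x SF sg _ _ ltac:(perm_atoms) sg1).
  - by rewrite /= !inE negb_or (neq_edge (jPQ p q pP qQ)) (neq_edge (jPQ p q' pP q'Q)) eq_sym qq'.
  - by apply/allP; rewrite /= -PQ !inE pP qQ q'Q !orbT.
have half P' Q' : leftover P' Q' -> 1 < #|P'| -> 1 < #|Q'| -> connector P' Q' x ->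
    ~~ connector P' Q' y -> ~~ connector P' Q' b ->
    half_reduct [set x; y; b] [set x] P' Q'.
  move=> l P'1 Q'1 cx' cy' cb' u.
  have nC v : ~~ connector P' Q' v -> ~~ full P' v -> full Q' v.
    by rewrite negb_and !negbK => /orP[->|].
  have nC' v : ~~ connector P' Q' v -> ~~ full Q' v -> full P' v.
    by rewrite negb_and !negbK => /orP[->|->].
  have cx'' : connector Q' P' x by rewrite /connector andbC.
  rewrite !inE -orbA => /andP[ux /or3P[]/eqP E]; rewrite {u}E ?eqxx // in ux *; move=> fu.
  - have fb := nC b cb' (opp _ _ l Q'1 cx' fu).
    right=> q qQ; apply: (@repairableI _ _ _ b x); rewrite ?inE ?eqxx ?orbT // 1?eq_sym //.
    rewrite /seagull (e_sym b) exb andbT e_sym (fullP _ _ fb) //= e_sym.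
    by rewrite (e_tri exy) // (fullP _ _ fu).
  - have fy : full Q' y.
      by apply: nC => //; apply: contraL fu; apply: (opp _ _ (leftoverC l)).
    left; have /andP[/not_fullP[p pP xp] _] := cx'; exists p => //.
    apply: (@repairableI _ _ _ x y); rewrite ?inE ?eqxx ?orbT //.
    by rewrite [X in _ || X]/seagull exy xp (full_notin l fy) ?orbT.
have tot v : ~~ connector P Q v -> full Q v || full P v.
  by rewrite negb_and !negbK orbC.
have notboth v : full Q v -> full P v -> False.
  have [_ _ /set0Pn[p pP] _] := lo.
  by move=> fQ /fullP/(_ p pP); apply/negP; apply: (full_notin lo fQ).
split; [by rewrite cards1 | by apply: half | by apply: half; rewrite ?cC | |].
- move=> u v; rewrite !inE -!orbA => /andP[ux] /or3P[]/eqP E /andP[vx] /or3P[]/eqP E';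
    rewrite {u}E {v}E' ?eqxx // in ux vx *; move=> fu fv.
  + by case: (notboth y).
  + by have := opp _ _ lo Q1 cx fu; rewrite fv.
  + by have := opp Q P lo' P1; rewrite cC fu => /(_ cx fv).
  + by case: (notboth b).
- by move=> u; rewrite !inE -!orbA => /andP[ux] /or3P[]/eqP E; rewrite {u}E ?eqxx // in ux *; apply: tot.
Qed.

(** Only [x] is kept; when it is released, any [p] in [P] forms a seagull with [y] and [b], as [b]
    is on the same side as [x]. *)
Lemma reduct_none P Q x y b : leftover P Q -> seagull x y b ->
  full Q x -> full P y -> full Q b ->
  reduct [set x; y; b] [set b; y] P Q.
Proof.
move=> lo sg fx fy fb; have [exy exb eyb] := and3P sg.
have := seagull_uniq sg; rewrite /= !inE negb_or andbT => /andP[/andP[xy xb] yb].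
have only u : u \in [set x; y; b] :\: [set b; y] -> u = x.
  rewrite !inE negb_or -!orbA => /andP[/andP[ub uy]].
  by rewrite (negPf ub) (negPf uy) !orbF => /eqP.
have [_ _ P0 Q0] := lo; have /set0Pn[p pP] := P0.
have nPx : ~~ full P x.
  by apply/negP => /fullP/(_ p pP); rewrite (negPf (full_notin lo fx _)).
split.
- by rewrite cards2 (eq_sym b) yb.
- move=> u /only-> _; left; exists p => //.
  apply: (@repairableI _ _ _ y b); rewrite ?inE ?eqxx ?orbT // 1?eq_sym //.
  by rewrite /seagull e_sym (fullP _ _ fy) // e_sym (full_notin lo fb) ?eyb.
- by move=> u /only->; rewrite (negPf nPx).
- by move=> u v _ /only-> _; rewrite (negPf nPx).
- by move=> u /only->; rewrite fx.
Qed.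

(** Otherwise [u] and [v] both miss some [p0] and both see another vertex [p1]. They are then
    nonadjacent, so they are [b] and an end [z]; with [w] the other end and [q] in [Q], the triples
    [p0], [q], [z] and [b], [p1], [w] are disjoint seagulls. *)
Lemma distinct_partners P Q x y b u v : leftover P Q -> 1 < #|P| ->
  [set x; y; b] \in F -> seagull x y b -> u \in [set x; y; b] ->
  v \in [set x; y; b] -> u != v -> connector P Q u -> connector P Q v ->
  exists p p', [/\ p \in P, p' \in P, p != p', ~~ e u p & ~~ e v p'].
Proof.
move=> lo P1 SF sg uS vS uv /andP[/not_fullP[p0 p0P up0] _] /andP[/not_fullP[p0' p0'P vp0'] _].
have [E|n] := eqVneq p0 p0'; last by exists p0, p0'; split.
rewrite -{}E {p0' p0'P} in vp0'.
have [p1 p1P p10] := card_gt1_neq p0 P1; have p01 : p0 != p1 by rewrite eq_sym.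
have [up1|up1] := boolP (e u p1); last by exists p1, p0; split.
have [vp1|vp1] := boolP (e v p1); last by exists p0, p1; split.
have [PQ jPQ _ /set0Pn[q qQ]] := lo.
have lone z w : [set x; y; b] = [set z; w; b] -> seagull z w b ->
    ~~ e z p0 -> e z p1 -> e b p1 -> False.
  move=> E sg' zp0 zp1 bp1; rewrite {}E in SF; have [ezw ezb ewb] := and3P sg'.
  have sg1 : seagull p0 q z.
    rewrite /seagull jPQ // e_sym zp0 e_sym (e_tri zp1) // jPQ //.
  have /negP[] : ~~ seagull b p1 w.
    apply: (@no_two_triple z w b p0 q p1 p0 q z b p1 w SF sg' _ _ ltac:(perm_atoms) sg1).
    - rewrite /= !inE negb_or (neq_edge (jPQ p0 q p0P qQ)) p01 eq_sym.
      by rewrite (neq_edge (jPQ p1 q p1P qQ)).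
    - by apply/allP; rewrite /= -PQ !inE p0P p1P qQ !orbT.
  by rewrite /seagull bp1 e_sym ewb e_sym (e_tri _ zp1) // e_sym.
have sg' : seagull y x b by rewrite seagullC.
have SE : [set x; y; b] = [set y; x; b] by rewrite (setUC [set x]).
have nuv : ~~ e u v by apply: (e_tri up1); rewrite e_sym.
have [exy _ _] := and3P sg.
move: uS vS; rewrite !inE -!orbA => /or3P[]/eqP E /or3P[]/eqP E';
  subst u v; rewrite ?eqxx // in uv.
- by rewrite exy in nuv.
- by case: (lone x y).
- by rewrite e_sym exy in nuv.
- by case: (lone y x).
- by case: (lone x y).
- by case: (lone y x).
Qed.

(** Two connectors would each form a seagull with one leftover vertex from either side, and by
    [distinct_partners] these seagulls can be made disjoint. *)
Lemma one_connector P Q x y b u v : leftover P Q -> 1 < #|P| -> 1 < #|Q| ->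
  [set x; y; b] \in F -> seagull x y b -> u \in [set x; y; b] ->
  v \in [set x; y; b] -> u != v -> connector P Q u -> ~~ connector P Q v.
Proof.
move=> lo P1 Q1 SF sg uS vS uv cu; apply/negP => cv.
have cC w : connector Q P w = connector P Q w by rewrite /connector andbC.
have [p [p' [pP p'P pp' up vp']]] := distinct_partners lo P1 SF sg uS vS uv cu cv.
have [||q [q' [qQ q'Q qq' uq vq']]] :=
  distinct_partners (leftoverC lo) Q1 SF sg uS vS uv; rewrite ?cC //.
have [PQ jPQ _ _] := lo.
have sg1 : seagull p q u by rewrite /seagull jPQ // e_sym up e_sym uq.
have /negP[] : ~~ seagull p' q' v.
  apply: (@no_two_cat [set x; y; b] [:: p; p'; q; q'] [:: u; v] p q u p' q' v SF _ _ _ _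
    ltac:(perm_atoms) sg1).
  - rewrite /= !inE !negb_or pp' qq' !(neq_edge (jPQ _ _ _ _)) //.
  - by rewrite /= inE uv.
  - by apply/allP; rewrite /= -PQ !inE pP p'P qQ q'Q !orbT.
  - by apply/allP; rewrite /= uS vS.
by rewrite /seagull jPQ // e_sym vp' e_sym vq'.
Qed.

(** The connector, if there is one, is discarded. Without one, the ends lie on opposite sides, and
    [b] is discarded with the end on the side opposite to [b]. *)
Lemma reduct_exists P Q S : leftover P Q -> 1 < #|P| -> 1 < #|Q| -> S \in F ->
  exists D, reduct S D P Q.
Proof.
move=> lo P1 Q1 SF; have [_ _ sF] := pF.
have [x [y [b [E sg]]]] := sF _ SF; rewrite {S}E in SF *.
have := seagull_uniq sg; rewrite /= !inE negb_or andbT => /andP[/andP[xy xb] yb].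
have sg' : seagull y x b by rewrite seagullC.
have SE : [set x; y; b] = [set y; x; b] by rewrite (setUC [set x]).
have SF' : [set y; x; b] \in F by rewrite -SE.
have one := one_connector lo P1 Q1 SF sg.
have xS : x \in [set x; y; b] by rewrite !inE eqxx.
have yS : y \in [set x; y; b] by rewrite !inE eqxx orbT.
have bS : b \in [set x; y; b] by rewrite !inE eqxx !orbT.
have [cb|cb] := boolP (connector P Q b).
  exists [set b]; apply: reduct_middle => //; apply: (one b) => //; by rewrite eq_sym.
have [cx|cx] := boolP (connector P Q x).
  by exists [set x]; apply: reduct_end => //; apply: (one x).
have [cy|cy] := boolP (connector P Q y).
  by exists [set y]; rewrite SE; apply: reduct_end.
have lo' := leftoverC lo; have [exy _ _] := and3P sg.
have eyx : e y x by rewrite e_sym.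
have cC v : connector Q P v = connector P Q v by rewrite /connector andbC.
have dich v : ~~ connector P Q v -> full Q v \/ full P v.
  by rewrite negb_and !negbK => /orP[]; [right | left].
case: (dich x cx) => fx; case: (dich b cb) => fb.
- by exists [set b; y]; apply: reduct_none => //; apply: full_opposite lo exy _ fx.
- exists [set b; x]; apply: reductC; rewrite SE.
  by apply: reduct_none => //; apply: full_opposite lo exy _ fx.
- exists [set b; x]; rewrite SE; apply: reduct_none => //.
  by apply: full_opposite lo' exy _ fx; rewrite cC.
- exists [set b; y]; apply: reductC; apply: reduct_none => //.
  by apply: full_opposite lo' exy _ fx; rewrite cC.
Qed.

Lemma leftover_notin S v : S \in F -> v \in S -> v \notin J :\: cover F.
Proof. by move=> SF vS; rewrite inE negb_and negbK; apply/orP; left; apply/bigcupP; exists S. Qed.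

(** Otherwise [S] and [S'] could be traded for three disjoint seagulls: their repairs with [l] and
    [l'], and one on [u], [t], [u']. *)
Lemma repaired_seagulls S S' u u' l l' t : S \in F -> S' \in F -> S != S' ->
  u \in S -> u' \in S' -> repairable S u l -> repairable S' u' l' ->
  uniq [:: l; l'; t] -> {subset [:: l; l'; t] <= J :\: cover F} ->
  ~~ seagull u t u' && ~~ seagull u' t u.
Proof.
move=> SF S'F SS' uS u'S' [t1 sg1 sub1] [t2 sg2 sub2] ul subl.
have [_ cov _] := pF.
have SJ A v : A \in F -> v \in A -> v \in J.
  by move=> AF vA; apply: (subsetP cov); apply/bigcupP; exists A.
have lJ v : v \in [:: l; l'; t] -> v \in J by move/subl; rewrite inE => /andP[].
have out A v : A \in F -> v \in A -> v \notin [:: l; l'; t].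
  by move=> AF vA; apply: contra (leftover_notin AF vA); apply: subl.
have dis v : v \in S -> v \notin S'.
  move=> vS; have /pred0P/(_ v) := trivIsetP (let: And3 h _ _ := pF in h) _ _ SF S'F SS'.
  by rewrite /= vS /= => ->.
pose F2 := F :\ S :\ S'.
have cF2 : #|F| = (#|F2|).+2.
  by rewrite (cardsD1 S F) SF (cardsD1 S' (F :\ S)) !inE eq_sym SS' S'F.
have F2F : F2 \subset F by rewrite /F2 !subDset; apply/subsetP => A; rewrite !inE => ->; rewrite !orbT.
have free v : v \in [:: l; l'; t] \/ v \in S \/ v \in S' -> v \in J :\: cover F2.
  case=> [vl|[vS|vS']]; rewrite in_setD.
  - rewrite lJ // andbT; apply/bigcupP => -[A AF vA].
    by have := out A v (subsetP F2F _ AF) vA; rewrite vl.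
  - by rewrite (SJ S) // andbT (packing_disjoint pF SF _ F2F vS) // /F2 !inE eqxx andbF.
  - by rewrite (SJ S') // andbT (packing_disjoint pF S'F _ F2F vS') // /F2 !inE eqxx.
rewrite -negb_or; apply/negP => sg; case: maxF.
have [t3 sg3 sub3] : exists2 t3, is_seagull t3 & perm_eq (vertices t3) [:: t; u; u'].
  by case/orP: sg => sg; [exists (u, t, u') | exists (u', t, u)]; rewrite // /vertices /=; perm_atoms.
have -> : #|F|.+1 = #|F2| + 3 by rewrite cF2 addn3.
have uv t0 : is_seagull t0 -> uniq (vertices t0) by apply: seagull_uniq.
move: ul; rewrite /= !inE negb_or andbT => /andP[/andP[ll' lt] l't].
have in1 v : v \in vertices t1 -> v = l \/ (v != u /\ v \in S).
  by move/sub1; rewrite !inE => /orP[/eqP|/andP[]]; [left | right].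
have in2 v : v \in vertices t2 -> v = l' \/ (v != u' /\ v \in S').
  by move/sub2; rewrite !inE => /orP[/eqP|/andP[]]; [left | right].
have in3 v : v \in vertices t3 -> [\/ v = t, v = u | v = u'].
  by rewrite (perm_mem sub3) !inE => /or3P[]/eqP; [constructor 1|constructor 2|constructor 3].
have oS v : v \in S -> [&& v != l, v != l' & v != t].
  by move/(out _ _ SF); rewrite !inE !negb_or.
have oS' v : v \in S' -> [&& v != l, v != l' & v != t].
  by move/(out _ _ S'F); rewrite !inE !negb_or.
have E3 : flatten (map vertices [:: t1; t2; t3]) =
          vertices t1 ++ vertices t2 ++ vertices t3 by [].
apply: (@packing_extend J F2 [:: t1; t2; t3]).
- exact: packing_sub pF F2F.
- by rewrite /= sg1 sg2 sg3.
- rewrite E3 !cat_uniq !uv //.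
  rewrite !andTb andbT; apply/andP; split; apply/hasPn => v.
  + rewrite mem_cat => h; apply/negP => /in1 h1; move: h => /orP[/in2|/in3] h.
    * case: h1 h => [->|[vu vS]] [E|[vu' vS']].
      - by rewrite E eqxx in ll'.
      - by have := oS' _ vS'; rewrite eqxx.
      - by have := oS _ vS; rewrite E eqxx andbF.
      - by have := dis _ vS; rewrite vS'.
    * case: h1 h => [->|[vu vS]] [E|E|E].
      - by rewrite E eqxx in lt.
      - by have := oS _ uS; rewrite E eqxx.
      - by have := oS' _ u'S'; rewrite E eqxx.
      - by have := oS _ vS; rewrite E eqxx !andbF.
      - by rewrite E eqxx in vu.
      - by have := dis _ vS; rewrite E u'S'.
  + move=> h; apply/negP => /in2 h2; move/in3: h => h.
    case: h2 h => [->|[vu vS]] [E|E|E].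
    * by rewrite E eqxx in l't.
    * by have := oS _ uS; rewrite E eqxx andbF.
    * by have := oS' _ u'S'; rewrite E eqxx andbF.
    * by have := oS' _ vS; rewrite E eqxx !andbF.
    * by have := dis _ uS; rewrite -E vS.
    * by rewrite E eqxx in vu.
- move=> v; rewrite E3 !mem_cat.
  case/or3P => [/in1|/in2|/in3]; move=> h; apply: free.
  + by case: h => [->|[_ ->]]; [left; rewrite !inE eqxx | right; left].
  + by case: h => [->|[_ ->]]; [left; rewrite !inE eqxx orbT | right; right].
  + case: h => [->|->|->]; [left; rewrite !inE eqxx !orbT // | right; left | right; right]; by [].
Qed.

(* In the complement of [e], this limits how much of [J] two anticomplete cliques
   can cover (with [P] or [Q] possibly empty). *)
Definition thin s := forall P Q, P \subset J -> Q \subset J ->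
  stable P -> stable Q -> joined P Q -> #|P| + #|Q| + 2 * s <= #|J| + 1.

(* Each seagull of [F] loses at most two vertices to [X], so that [J :\: X] is too
   large to be complete bipartite. A missing edge [u u'] extends to a seagull by
   a leftover vertex, and two more leftover vertices repair the seagulls that
   contained [u] and [u']. *)
Lemma wide_leftover_not_thin P Q :
  leftover P Q -> 1 < #|P| -> 1 < #|Q| -> ~ thin #|F|.+1.
Proof.
move=> lo P1 Q1 th; have [_ cov sF] := pF; have [PQ jPQ P0 Q0] := lo.
have [D red] : exists D : {set V} -> {set V}, forall S, S \in F -> reduct S (D S) P Q.
  apply: (@fin_all_exists _ _ (fun S D => S \in F -> reduct S D P Q)) => S.
  have [SF|SF] := boolP (S \in F); last by exists set0.
  by have [D red] := reduct_exists lo P1 Q1 SF; exists D.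
pose X := \bigcup_(S in F) D S; pose W := J :\: X.
have cX : #|X| <= 2 * #|F|.
  rewrite mulnC -sum_nat_const /X.
  elim/big_rec2: _ => [|S n A SF IH]; first by rewrite cards0.
  by apply: leq_trans (leq_card_setU _ _) _; apply: leq_add IH; case: (red S SF).
pose P' := [set v in W | full Q v]; pose Q' := [set v in W | full P v].
have loC v : v \in J :\: cover F -> full Q v || full P v.
  rewrite -PQ inE => /orP[vP|vQ]; apply/orP; [left | right]; apply/fullP => w wQ.
    exact: jPQ.
  by rewrite e_sym; apply: jPQ.
have inS v : v \in W -> v \in cover F -> exists S, [/\ S \in F, v \in S & v \in S :\: D S].
  rewrite inE => /andP[vX _] /bigcupP[S SF vS]; exists S; split=> //.
  by rewrite inE vS andbT; apply: contra vX => vD; apply/bigcupP; exists S.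
have WPQ : W = P' :|: Q'.
  apply/setP => v; rewrite [RHS]inE !inE -andb_orr.
  case: (boolP (v \in W)); rewrite !inE => vW; last by rewrite (negPf vW).
  rewrite vW /=; have [vF|vF] := boolP (v \in cover F); last first.
    by rewrite loC // inE vF; case/andP: vW.
  have [|S [SF vS vD]] := inS v _ vF; first by rewrite inE.
  by have [_ _ _ _ ->] := red S SF.
have subW A (h : pred V) : A = [set v in W | h v] -> A \subset J.
  by move=> ->; apply/subsetP => v; rewrite !inE => /andP[/andP[_ ->]].
have jn : ~ joined P' Q'.
  move=> jn; have := th P' Q' (subW _ _ erefl) (subW _ _ erefl).
  have cW : #|J| <= #|W| + #|X|.
    by rewrite -(cardsID X J) addnC leq_add2l subset_leq_card // subsetIr.
  have cPQ : #|W| <= #|P'| + #|Q'| by rewrite WPQ cardsU leq_subr.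
  have st : stable P' by move=> u v; rewrite !inE => /andP[_ fu] /andP[_ fv]; apply: full_stable Q0 fu fv.
  have st' : stable Q' by move=> u v; rewrite !inE => /andP[_ fu] /andP[_ fv]; apply: full_stable P0 fu fv.
  move=> /(_ st st' jn); move: cX cW cPQ; clear; lia.
apply: jn => u u' uP' u'Q'; apply/negPn/negP => uu'.
have [[uW fu] [u'W fu']] := (setIdP uP', setIdP u'Q').
have covF v : v \in W -> v \notin P -> v \notin Q -> v \in cover F.
  move=> vW vP vQ; apply: contraNT vP => vF.
  have : v \in P :|: Q by rewrite PQ inE vF; case/setDP: vW.
  by rewrite inE (negPf vQ) orbF.
have uF : u \in cover F.
  apply: covF => //; apply/negP => h.
    by move: uu'; rewrite e_sym (fullP _ _ fu' u h).
  by have := fullP _ _ fu u h; rewrite e_irr.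
have u'F : u' \in cover F.
  apply: covF => //; apply/negP => h.
    by have := fullP _ _ fu' u' h; rewrite e_irr.
  by move: uu'; rewrite (fullP _ _ fu u' h).
have [S [SF uS uD]] := inS u uW uF; have [S' [S'F u'S' u'D]] := inS u' u'W u'F.
have [_ half _ cross _] := red S SF; have [_ _ half' _ _] := red S' S'F.
have SS' : S != S'.
  apply/eqP => E; rewrite -E in u'D.
  by move: uu'; rewrite cross.
have disj p q : p \in P -> q \in Q -> p != q by move=> pP qQ; apply: neq_edge; apply: jPQ.
have [l [l' [ll lS lS' ll']]] : exists l l', [/\ {subset [:: l; l'] <= P :|: Q},
    repairable S u l, repairable S' u' l' & l != l'].
  have all2P p q : p \in P :|: Q -> q \in P :|: Q -> {subset [:: p; q] <= P :|: Q}.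
    by move=> pL qL; apply/allP; rewrite /= pL qL.
  have inP p : p \in P -> p \in P :|: Q by rewrite inE => ->.
  have inQ q : q \in Q -> q \in P :|: Q by rewrite inE orbC => ->.
  case: (half u uD fu) => [[p pP rp]|r]; case: (half' u' u'D fu') => [[q qQ rq]|r'].
  - by exists p, q; split; rewrite ?disj //; apply: all2P; [exact: inP | exact: inQ].
  - have [p' p'P pp'] := card_gt1_neq p P1.
    by exists p, p'; split; rewrite 1?eq_sym //; [apply: all2P; exact: inP | exact: r'].
  - have [q' q'Q qq'] := card_gt1_neq q Q1.
    by exists q', q; split; rewrite //; [apply: all2P; exact: inQ | exact: r].
  - have [/set0Pn[p pP] /set0Pn[q qQ]] := (P0, Q0).
    exists q, p; split; [by apply: all2P; [exact: inQ | exact: inP]|exact: r|exact: r'|].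
    by rewrite eq_sym disj.
(* A third leftover vertex, available since each side has at least two. Each of [u], [u'] is joined
   to one side and misses the other, so [t] is adjacent to exactly one of them and forms a seagull
   with both. *)
have [t tL tl] : exists2 t, t \in P :|: Q & t \notin [:: l; l'].
  have cPQ : 3 < #|P :|: Q|.
    have -> : #|P :|: Q| = #|P| + #|Q|.
      apply/eqP; rewrite (leq_card_setU P Q); apply/pred0P => v /=.
      by apply/negP => /andP[vP vQ]; have := disj v v vP vQ; rewrite eqxx.
    exact: (leq_add P1 Q1).
  have /subsetPn[t tL tl] : ~~ (P :|: Q \subset [:: l; l']).
    apply/negP => /subset_leq_card /(leq_trans cPQ) /leq_trans/(_ (card_size _)).
    by [].
  by exists t.
have := repaired_seagulls SF S'F SS' uS u'S' lS lS' (t := t).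
case/(_ _ _)/andP.
- by move: tl; rewrite /= !inE !negb_or ll' !(eq_sym t) => /andP[-> ->].
- move=> v; rewrite -PQ in_cons => /orP[/eqP->|]; first by apply: ll; rewrite inE eqxx.
  by rewrite !in_cons in_nil orbF => /orP[/eqP->|/eqP-> //]; apply: ll; rewrite !inE eqxx orbT.
move: tL; rewrite inE => /orP[tP|tQ] /negP n1 /negP n2.
- by apply: n2; rewrite /seagull (fullP _ _ fu') // e_sym uu' e_sym (full_notin lo fu).
- by apply: n1; rewrite /seagull (fullP _ _ fu) // uu' e_sym (full_notin (leftoverC lo) fu').
Qed.

End NoImprovement.

(** There are finitely many candidate packings and the conditions are decidable, so the case split
    is constructive. *)
Lemma has_seagullsP n J : has_seagulls n J \/ ~ has_seagulls n J.
Proof.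
pose sgb S := [exists x, exists y, exists b, (S == [set x; y; b]) && seagull x y b].
have sgP S : reflect (seagull_set S) (sgb S).
  apply: (iffP existsP) => [[x /existsP[y /existsP[b /andP[/eqP E sg]]]]|[x [y [b [-> sg]]]]].
    by exists x, y, b.
  by exists x; apply/existsP; exists y; apply/existsP; exists b; rewrite eqxx.
case: (boolP [exists F : {set {set V}},
  [&& trivIset F, cover F \subset J, [forall S in F, sgb S] & #|F| == n]]) => h.
  left; have /existsP[F /and4P[tF cF /forall_inP sF /eqP nF]] := h.
  by exists F => //; split=> // S /sF /sgP.
right=> -[F [tF cF sF] nF]; case/existsP: h; exists F; rewrite tF cF nF eqxx andbT /=.
by apply/forall_inP => S /sF /sgP.
Qed.

(** The neighbours of [a] in [J] contain [P] and the hits, and form a stable set joined to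
    [[set a]]. Thinness bounds their number, and [#|J| = 3 * #|F| + #|P| + 1] leaves fewer than
    [#|F|] hits. *)
Lemma thin_hits J F P a : packing J F -> leftover J F P [set a] -> thin J #|F|.+1 ->
  #|[set v in cover F | e a v]| < #|F|.
Proof.
move=> pF [PL jP _ _] th; have [_ cov _] := pF.
have inL v : v \in P :|: [set a] -> (v \in J) && (v \notin cover F).
  by rewrite PL inE andbC.
have aP p : p \in P -> e a p by move=> pP; rewrite e_sym jP ?inE.
have [aL PsubL] : a \in P :|: [set a] /\ {subset P <= P :|: [set a]}.
  by split=> [|v vP]; rewrite !inE ?eqxx ?vP ?orbT.
have /andP[aJ aF] := inL a aL.
set H := [set v in cover F | e a v]; set N := [set v in J | e a v].
have NJ : N \subset J by apply/subsetP => v; rewrite inE => /andP[].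
have stN : stable N.
  by move=> u v; rewrite !inE => /andP[_ au] /andP[_ av]; apply: (@e_tri _ a); rewrite // e_sym.
have sta : stable [set a] by move=> u v; rewrite !inE => /eqP-> /eqP->; rewrite e_irr.
have jN : joined N [set a] by move=> u v; rewrite !inE => /andP[_ au] /eqP->; rewrite e_sym.
have aJ' : [set a] \subset J by rewrite sub1set.
have := th _ _ NJ aJ' stN sta jN; rewrite cards1 => {th}bound.
have cL : #|P| + 1 = #|J| - #|cover F|.
  have -> : #|J| - #|cover F| = #|P :|: [set a]| by rewrite PL cardsDS.
  have : [disjoint P & [set a]].
    by apply/pred0P => v /=; apply/negP; rewrite inE => /andP[/aP av /eqP E]; rewrite E e_irr in av.
  by rewrite -(leq_card_setU P [set a]) cards1 => /eqP.
have cN : #|P| + #|H| <= #|N|.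
  have dPH : [disjoint P & H].
    apply/pred0P => v /=; apply/negP; rewrite inE => /and3P[vP vF _].
    by have /andP[_] := inL v (PsubL v vP); rewrite vF.
  move: dPH; rewrite -(leq_card_setU P H) => /eqP<-.
  apply: subset_leq_card; apply/subsetP => v; rewrite !inE => /orP[vP|/andP[vF ->]].
    by rewrite aP // andbT; have /andP[] := inL v (PsubL v vP).
  by rewrite (subsetP cov).
have := subset_leq_card cov; move: bound cL cN; rewrite (packing_cover pF).
clear; lia.
Qed.

(* [a; c; y] replaces [x; y; b], and [x] and [b] become the small side. *)
Lemma widen_leftover_at J F P a x y b :
  packing J F -> leftover J F P [set a] -> 2 < #|P| ->
  [set x; y; b] \in F -> seagull x y b -> ~~ e a y ->
  {in P, forall c, e b c} -> {in P, forall c, e x c} ->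
  exists F' P' Q', [/\ packing J F', #|F'| = #|F|, leftover J F' P' Q',
    1 < #|P'| & 1 < #|Q'|].
Proof.
set S := [set x; y; b] => pF lo P3 SF sg ay bP xP; have [PL jP _ _] := lo.
have [exy exb eyb] := and3P sg; have [_ cov _] := pF.
have := seagull_uniq sg; rewrite /= !inE negb_or andbT => /andP[/andP[xy xb] yb].
have aP p : p \in P -> e a p by move=> pP; rewrite e_sym jP ?inE.
have [c cP] : exists c, c \in P by apply/set0Pn; rewrite -card_gt0; lia.
pose C := cover (F :\ S).
have FE : cover F = S :|: C by rewrite -coverU1 setD1K.
have SC v : v \in S -> v \notin C.
  by move=> vS; apply: (packing_disjoint pF SF); rewrite ?subsetDl // !inE eqxx.
have SJ v : v \in S -> v \in J by move=> vS; apply: (subsetP cov); rewrite FE inE vS.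
have PE v : (v \in P) || (v == a) = [&& v \in J, v \notin S & v \notin C].
  have : (v \in P :|: [set a]) = (v \in J :\: cover F) by rewrite PL.
  by rewrite FE !in_setD in_setU in_setU in_set1 negb_or andbC => ->.
have [aJ aS aC] : [/\ a \in J, a \notin S & a \notin C].
  by apply/and3P; rewrite -PE eqxx orbT.
have [cJ cS cC] : [/\ c \in J, c \notin S & c \notin C].
  by apply/and3P; rewrite -PE cP.
have sg' : seagull a c y.
  by rewrite /seagull aP // ay (e_tri (y := x)) // e_sym xP.
have [xS yS bS] : [/\ x \in S, y \in S & b \in S].
  by rewrite /S !inE !eqxx !orbT.
have [] := @packingU1 J (F :\ S) a c y _ sg' _.
- exact: packing_sub pF (subsetDl _ _).
- apply/subsetP => v; rewrite !inE -orbA -/C => /or3P[]/eqP->;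
    by rewrite ?aC ?aJ ?cC ?cJ ?(SC y) ?(SJ y).
move=> pF' cF'; exists ([set a; c; y] |: (F :\ S)), (P :\ c), [set x; b].
split=> //.
- by rewrite cF' [RHS](cardsD1 S F) SF.
- split.
  + apply/setP => v; rewrite coverU1 -/C !inE.
    have aP' : a \notin P by apply/negP => /aP; rewrite e_irr.
    have := PE v; have [vS|vS] := boolP (v \in S).
      rewrite andbF => /negbT; rewrite negb_or => /andP[/negPf-> va].
      have vc : v != c by apply: contraNneq cS => <-.
      rewrite (negPf va) (negPf vc) (SJ v vS) (negPf (SC v vS)) orbF /=.
      by move: vS; rewrite !inE -orbA => /or3P[]/eqP->; rewrite ?eqxx ?orbT // 1?eq_sym;
        rewrite ?(negPf xy) ?(negPf yb) // eq_sym (negPf xy).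
    move: (vS); rewrite !inE !negb_or => /andP[/andP[/negPf-> /negPf->] /negPf->].
    rewrite !orbF /= andbT => PEv.
    have [->|va] := eqVneq v a; first by rewrite (negPf aP') andbF.
    by move: PEv; rewrite (negPf va) orbF => ->; case: (v != c); rewrite ?andbF //= andbC.
  + move=> p q; rewrite !inE => /andP[_ pP] /orP[]/eqP->; by rewrite e_sym ?xP ?bP.
  + rewrite -card_gt0; move: P3; rewrite (cardsD1 c P) cP; clear; lia.
  + by apply/set0Pn; exists x; rewrite !inE eqxx.
- move: P3; rewrite (cardsD1 c P) cP; clear; lia.
- by rewrite cards2 xb.
Qed.

(** By [thin_hits] some seagull of [F] contains no neighbour of [a]; [missed_triple] then provides
    the vertices for the exchange, up to swapping the two ends. *)
Lemma widen_leftover J F P a :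
  packing J F -> ~ has_seagulls #|F|.+1 J -> thin J #|F|.+1 ->
  leftover J F P [set a] -> 2 < #|P| ->
  exists F' P' Q', [/\ packing J F', #|F'| = #|F|, leftover J F' P' Q',
    1 < #|P'| & 1 < #|Q'|].
Proof.
move=> pF maxF th lo P3; have hits := thin_hits pF lo th.
have [S SF Sa] : exists2 S, S \in F & {in S, forall v, ~~ e a v}.
  case: (boolP [exists S in F, [forall v in S, ~~ e a v]]) => [/exists_inP[S SF /forall_inP h]|].
    by exists S.
  move=> none; have hit A : A \in F -> exists2 v, v \in A & e a v.
    move=> AF; have /forall_inPn[v vA /negPn av] : ~~ [forall v in A, ~~ e a v].
      by apply: contra none => h; apply/exists_inP; exists A.
    by exists v.
  by have := count_hits pF hit; rewrite leqNgt hits.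
have [_ _ sF] := pF; have [x [y [b [E sg]]]] := sF _ SF; rewrite {S}E in SF Sa.
have [ax ay ab] : [/\ ~~ e a x, ~~ e a y & ~~ e a b].
  by split; apply: Sa; rewrite !inE eqxx ?orbT.
have [bP [xP|yP]] := missed_triple pF maxF lo P3 SF sg ax ay ab.
  exact: (widen_leftover_at pF lo P3 SF sg).
have SE : [set x; y; b] = [set y; x; b] by rewrite (setUC [set x]).
by apply: (widen_leftover_at pF lo P3 _ _ ax bP yP); [rewrite -SE | rewrite seagullC].
Qed.

(* The induction removes both ends of an [e]-edge, so the packing given by the
   induction hypothesis leaves an [e]-edge uncovered. *)
Lemma thin_has_seagulls s J : 3 * s < #|J| -> thin J s -> has_seagulls s J.
Proof.
elim: s J => [|s IH] J cJ th; first by exists set0; [exact: packing0 | rewrite cards0].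
have [u [v [uJ vJ uv]]] : exists u v, [/\ u \in J, v \in J & e u v].
  (* Without such an edge [J] would be stable and, paired with the empty set, would violate
     thinness. *)
  case: (boolP [exists u in J, [exists v in J, e u v]]) => [|none].
    by case/exists_inP => u uJ /exists_inP[v vJ uv]; exists u, v.
  have st : stable J.
    move=> u v uJ vJ; apply: contra none => uv.
    by apply/exists_inP; exists u => //; apply/exists_inP; exists v.
  have st0 : stable set0 by move=> ? ?; rewrite inE.
  have j0 : joined J set0 by move=> ? ? _; rewrite inE.
  have := th J set0 (subxx _) (sub0set _) st st0 j0; rewrite cards0; clear; lia.
have uv' := neq_edge uv.
have cJ' : #|J| = (#|J :\ u :\ v|).+2.
  by rewrite (cardsD1 u J) uJ (cardsD1 v (J :\ u)) !inE eq_sym uv' vJ.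
have J'J : J :\ u :\ v \subset J by rewrite (subset_trans (subsetDl _ _)) ?subsetDl.
(* Removing two vertices and asking for one seagull less lowers both sides of the thinness bound by
   two. *)
have [||F pF cF] := IH (J :\ u :\ v).
- move: cJ cJ'; clear; lia.
- move=> P Q PJ QJ stP stQ jPQ.
  have := th P Q (subset_trans PJ J'J) (subset_trans QJ J'J) stP stQ jPQ.
  by move: cJ'; clear; lia.
have [//|maxF] := has_seagullsP s.+1 J.
have pJF : packing J F by case: pF => tF cF' sF; split=> //; apply: subset_trans J'J.
have notF w : w \notin J :\ u :\ v -> w \notin cover F.
  by move=> wJ; apply: contra wJ; have [_ /subsetP cF' _] := pF; apply: cF'.
rewrite -cF in maxF th cJ *.
have [||P [Q lo]] := leftover_exists pJF maxF _ _ uv.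
- by rewrite inE uJ andbT notF // !inE eqxx andbF.
- by rewrite inE vJ andbT notF // !inE eqxx.
have cPQ : 3 < #|P| + #|Q|.
  have [PL _ _ _] := lo; have [_ cov _] := pJF.
  have := leq_card_setU P Q; rewrite PL cardsDS // (packing_cover pJF) => -[+ _].
  by move: cJ; clear; lia.
have wide F' P' Q' : packing J F' -> #|F'| = #|F| -> leftover J F' P' Q' ->
    1 < #|P'| -> 1 < #|Q'| -> has_seagulls #|F|.+1 J.
  move=> pF' E lo' P1 Q1; case: (@wide_leftover_not_thin J F' pF' _ P' Q') => //.
    by rewrite E.
  by rewrite E.
have narrow P' Q' : leftover J F P' Q' -> #|Q'| <= 1 -> 3 < #|P'| + #|Q'| ->
    has_seagulls #|F|.+1 J.
  move=> lo' Q1 c'; have [_ _ _ Q0] := lo'.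
  have /cards1P[a E] : #|Q'| == 1 by rewrite eqn_leq Q1 card_gt0.
  rewrite E cards1 in lo' c'.
  have [|F' [P2 [Q2 [pF' cF' lo2 P1 Q21]]]] := widen_leftover pJF maxF th lo'.
    by move: c'; clear; lia.
  exact: wide pF' cF' lo2 P1 Q21.
have [Q1|Q1] := leqP #|Q| 1; first exact: narrow lo Q1 cPQ.
have [P1|P1] := leqP #|P| 1; last exact: (wide F P Q).
by apply: narrow (leftoverC lo) P1 _; rewrite addnC.
Qed.

End TriangleFree.

(** * Matchings and transversals *)

Section Linkage.

Variables (V : finType) (e : rel V).
Hypotheses (e_sym : symmetric e) (e_irr : irreflexive e).
Hypothesis e_tri : forall x y z, e x y -> e y z -> ~~ e x z.

Implicit Types (c r u v w x y : V) (T : {set V}) (mu : V -> V).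

(* A matching is encoded as an involution that fixes the unmatched vertices. *)
Definition matching mu :=
  [forall v, (mu (mu v) == v) && ((mu v != v) ==> e v (mu v))].

Lemma matchingP mu : reflect (involutive mu /\ forall v, mu v != v -> e v (mu v))
  (matching mu).
Proof.
apply: (iffP forallP) => [h|[inv me] v].
  by split=> v; have /andP[/eqP E /implyP] := h v.
by rewrite inv eqxx; apply/implyP; apply: me.
Qed.

(** The symmetric difference of the matching with the path [r], [x], [mu x], [r']. *)
Definition augment mu r x r' v :=
  if v == r then x else if v == x then r else
  if v == r' then mu x else if v == mu x then r' else mu v.

(** The unmatched ends [r] and [r'] are distinct because [r], [x], [mu x] would otherwise be a
    triangle. *)
Lemma augment_matching mu r x r' : matching mu -> mu r = r -> mu r' = r' ->
  mu x != x -> e r x -> e r' (mu x) ->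
  matching (augment mu r x r') /\
  [set v | mu v != v] \proper [set v | augment mu r x r' v != v].
Proof.
move=> /matchingP[inv me] fr fr' mx rx r'x; have exx := me x mx.
have nrr' : r != r'.
  by apply: contraTneq r'x => <-; apply: e_tri rx exx.
have nrx : r != x by apply: contraTneq rx => ->; rewrite e_irr.
have nr'x' : r' != mu x by apply: contraTneq r'x => ->; rewrite e_irr.
have nrx' : r != mu x by apply: contra_neq mx => E; rewrite -[RHS]inv -E fr.
have nr'x : r' != x by apply: contra_neq mx => E; rewrite -E.
have aug v : v != r -> v != x -> v != r' -> v != mu x ->
    [/\ augment mu r x r' v = mu v, mu v != r, mu v != x, mu v != r' & mu v != mu x].
  move=> vr vx vr' vx'; rewrite /augment (negPf vr) (negPf vx) (negPf vr') (negPf vx').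
  have inj := inv_inj inv; split=> //.
  - by rewrite -fr (inj_eq inj).
  - by rewrite -(inj_eq inj) inv.
  - by rewrite -fr' (inj_eq inj).
  - by rewrite (inj_eq inj).
have ar : augment mu r x r' r = x by rewrite /augment eqxx.
have ax : augment mu r x r' x = r by rewrite /augment eq_sym (negPf nrx) eqxx.
have ar' : augment mu r x r' r' = mu x.
  by rewrite /augment eq_sym (negPf nrr') (negPf nr'x) eqxx.
have ax' : augment mu r x r' (mu x) = r'.
  rewrite /augment (eq_sym _ r) (negPf nrx') (negPf mx) (eq_sym _ r') (negPf nr'x').
  by rewrite eqxx.
split.
  apply/matchingP; split=> v.
    have [->|vr] := eqVneq v r; first by rewrite ar.
    have [->|vx] := eqVneq v x; first by rewrite ax.
    have [->|vr'] := eqVneq v r'; first by rewrite ar'.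
    have [->|vx'] := eqVneq v (mu x); first by rewrite ax'.
    have [-> h1 h2 h3 h4] := aug v vr vx vr' vx'.
    by have [-> _ _ _ _] := aug (mu v) h1 h2 h3 h4; rewrite inv.
  have [->|vr] := eqVneq v r; first by rewrite ar.
  have [->|vx] := eqVneq v x; first by rewrite ax e_sym.
  have [->|vr'] := eqVneq v r'; first by rewrite ar'.
  have [->|vx'] := eqVneq v (mu x); first by rewrite ax' e_sym.
  by have [-> _ _ _ _] := aug v vr vx vr' vx'; apply: me.
apply/properP; split; last by exists r; rewrite !inE ?fr ?eqxx // ar eq_sym.
apply/subsetP => v; rewrite !inE => mv.
have [->|vr] := eqVneq v r; first by rewrite ar eq_sym.
have [->|vx] := eqVneq v x; first by rewrite ax.
have [->|vr'] := eqVneq v r'; first by rewrite ar' eq_sym.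
have [->|vx'] := eqVneq v (mu x); first by rewrite ax'.
by have [-> _ _ _ _] := aug v vr vx vr' vx'.
Qed.

Definition join mu r r' v := if v == r then r' else if v == r' then r else mu v.

Lemma join_matching mu r r' : matching mu -> mu r = r -> mu r' = r' -> e r r' ->
  matching (join mu r r') /\
  [set v | mu v != v] \proper [set v | join mu r r' v != v].
Proof.
move=> /matchingP[inv me] fr fr' rr'.
have nrr' : r != r' by apply: contraTneq rr' => ->; rewrite e_irr.
have jr : join mu r r' r = r' by rewrite /join eqxx.
have jr' : join mu r r' r' = r by rewrite /join eq_sym (negPf nrr') eqxx.
have joinE v : v != r -> v != r' -> join mu r r' v = mu v.
  by move=> vr vr'; rewrite /join (negPf vr) (negPf vr').
have inj := inv_inj inv.
split.
  apply/matchingP; split=> v.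
    have [->|vr] := eqVneq v r; first by rewrite jr.
    have [->|vr'] := eqVneq v r'; first by rewrite jr'.
    have vr1 : mu v != r by rewrite -{1}fr (inj_eq inj).
    have vr1' : mu v != r' by rewrite -{1}fr' (inj_eq inj).
    by rewrite joinE // joinE ?inv.
  have [->|vr] := eqVneq v r; first by rewrite jr.
  have [->|vr'] := eqVneq v r'; first by rewrite jr' e_sym.
  by rewrite joinE //; apply: me.
apply/properP; split; last by exists r; rewrite !inE ?fr ?eqxx // jr eq_sym.
apply/subsetP => v; rewrite !inE => mv.
have [->|vr] := eqVneq v r; first by rewrite jr eq_sym.
have [->|vr'] := eqVneq v r'; first by rewrite jr'.
by rewrite joinE.
Qed.

(** A matching with the most matched vertices admits no augmenting path; only those with one edge
    and with three edges are needed below. *)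
Lemma maximal_matching : exists2 mu, matching mu &
  (forall r r', mu r = r -> mu r' = r' -> ~~ e r r') /\
  (forall r r' x, mu r = r -> mu r' = r' -> mu x != x -> ~~ (e r x && e r' (mu x))).
Proof.
pose m (f : {ffun V -> V}) := #|[set v | f v != v]|.
have m0 : matching [ffun v : V => v].
  by apply/matchingP; split=> v; rewrite !ffunE // eqxx.
have [f fm fmax] := @arg_maxnP _ [ffun v => v] (fun f : {ffun V -> V} => matching f) m m0.
have noimp g : matching g -> ~ [set v | f v != v] \proper [set v | g v != v].
  move=> gm gp; have fE : finfun g =1 g by move=> v; rewrite ffunE.
  have gm' : matching (finfun g) by rewrite /matching; under eq_forallb => v do rewrite !fE.
  have : m (finfun g) <= m f := fmax _ gm'; rewrite /m leqNgt => /negP; apply.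
  apply: leq_trans (proper_card gp) _; apply: subset_leq_card.
  by apply/subsetP => v; rewrite !inE fE.
exists f => //; split=> [r r' fr fr'|r r' x fr fr' fx]; apply/negP.
  by move=> rr'; have [gm /(noimp _ gm)] := join_matching fm fr fr' rr'.
by case/andP=> rx r'x; have [gm /(noimp _ gm)] := augment_matching fm fr fr' fx rx r'x.
Qed.

Definition transversal mu T :=
  [forall v, (mu v != v) ==> ((v \in T) != (mu v \in T))].

(** It ensures that both ends of an [e]-edge inside [T] are matched, so that both have partners to
    route through. *)
Definition unhit mu T := [forall c in T, forall u in T, (mu c == c) ==> ~~ e c u].

Lemma card_transversal mu T : involutive mu -> transversal mu T ->
  #|[set v in T | mu v != v]| = #|[set v in ~: T | mu v != v]|.
Proof.
move=> inv /forallP tr; rewrite -(card_imset _ (inv_inj inv)); apply: eq_card => v.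
rewrite inE in_setC; apply/imsetP/andP => [[w + ->]|[vT mv]].
  rewrite inE inv eq_sym => /andP[wT mw]; have := tr w.
  by rewrite eq_sym mw wT /=; case: (_ \in _).
exists (mu v); rewrite ?inv // inE inv eq_sym mv andbT.
by have := tr v; rewrite mv (negPf vT) /=; case: (_ \in _).
Qed.

(** [R] is half of the unmatched vertices. As there is no augmenting path with three edges, [R] has
    neighbours at no more than one end of each matching edge, and an end without such neighbours
    goes into [T]. *)
Lemma transversal_exists mu : matching mu ->
  (forall r r', mu r = r -> mu r' = r' -> ~~ e r r') ->
  (forall r r' x, mu r = r -> mu r' = r' -> mu x != x -> ~~ (e r x && e r' (mu x))) ->
  exists T, [&& transversal mu T, unhit mu T & #|T| == uphalf #|V|].
Proof.
move=> /matchingP[inv me] stF nhit; pose Fx := [set v | mu v == v].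
have [|R RF cR] := @subset_of_card _ Fx (uphalf #|Fx|).
  by clear; lia.
have Rfix c : c \in R -> mu c = c by move/(subsetP RF); rewrite inE => /eqP.
pose hit v := [exists c in R, e c v].
have hit1 v : mu v != v -> ~~ (hit v && hit (mu v)).
  move=> mv; apply/negP => /andP[/exists_inP[c cR' cv] /exists_inP[c' c'R c'v]].
  by have := nhit c c' v (Rfix _ cR') (Rfix _ c'R) mv; rewrite cv c'v.
(* If one end of the matching edge is hit, the other end is chosen; if none is, the rank breaks the
   tie. *)
pose ch v := ~~ hit v && (hit (mu v) || (enum_rank v < enum_rank (mu v))).
pose T := [set v | if mu v == v then v \in R else ch v].
have tr : transversal mu T.
  apply/forallP => v; apply/implyP => mv; rewrite !inE inv (eq_sym v) (negPf mv).
  have := hit1 v mv; rewrite /ch inv.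
  case: (hit v); case: (hit (mu v)) => //= _.
  have : (enum_rank v : nat) != enum_rank (mu v).
    by apply: contra_neq mv => /ord_inj/enum_rank_inj.
  by case: ltngtP.
have un : unhit mu T.
  apply/forall_inP => c cT; apply/forall_inP => u uT; apply/implyP => fc.
  move: cT uT; rewrite !inE fc => cR'; case: ifP => [fu _|_].
    by apply: stF; [apply/eqP | apply/eqP].
  by rewrite /ch => /andP[+ _]; apply: contra => cu; apply/exists_inP; exists c.
exists T; rewrite tr un /=.
have := card_transversal inv tr.
have E1 := cardsID Fx T; have E2 := cardsID Fx (~: T); have E3 := cardsC T.
have -> : [set v in T | mu v != v] = T :\: Fx by apply/setP => v; rewrite !inE andbC.
have -> : [set v in ~: T | mu v != v] = ~: T :\: Fx by apply/setP => v; rewrite !inE andbC.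
have E4 : T :&: Fx = R.
  apply/setP => v; rewrite !inE; case: eqP => [_|mv]; rewrite ?andbT ?andbF //.
  by apply/esym/negP => /Rfix.
have := cardsID T Fx; rewrite setIC E4 cR.
have -> : Fx :\: T = ~: T :&: Fx by rewrite setDE setIC.
rewrite E4 cR in E1; move=> E5 E6.
have -> : #|V| = #|Fx| + (#|T :\: Fx|).*2.
  by move: E1 E2 E3 E5 E6; clear; lia.
rewrite -E1 !uphalf_half oddD odd_double addbF halfD odd_double andbF doubleK.
by rewrite add0n addnA.
Qed.

(* For an uncrossed [e]-edge [u v] of a transversal, [u; mu v; mu u; v] is a path
   in the complement of [e]; a crossed one needs a path [u; w; mu u; v] instead. *)
Definition crossed mu u v := e u v && e (mu u) (mu v).

(* The last condition keeps the edge [u w] off the paths of uncrossed edges. *)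
Definition supply mu T u :=
  [set w | [&& w \notin T, w != mu u, ~~ e w u, ~~ e w (mu u) & ~~ e (mu w) u]].

(** Sums over all vertices the indicator [h] of being adjacent to [u] or [u']; no vertex is adjacent
    to both, so the total is the sum of the two degrees. A vertex [w] of [X] fails to be supply only
    if [h] holds at [w] or [mu w]. The first two sets on the left give vertices [w] where it holds
    at both, a surplus of one each. *)
Lemma supply_count mu T u :
  matching mu -> transversal mu T -> u \in T -> mu u != u ->
  #|[set v in T | crossed mu u v]| + #|[set v in T :\ u | e (mu u) v && e u (mu v)]| +
    #|[set c in T | (mu c == c) && e c (mu u)]| + #|~: T| + 1 <=
  #|supply mu T u| + #|[set w | e u w]| + #|[set w | e (mu u) w]|.
Proof.
move=> /matchingP[inv me] /forallP tr uT mu_u; set u' := mu u.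
have inj := inv_inj inv; have euu' : e u u' by apply: me.
have u'T : u' \notin T.
  by have := tr u; rewrite mu_u uT /=; case: (_ \in _).
have muT v : mu v != v -> (mu v \in T) = (v \notin T).
  by move=> mv; have := tr v; rewrite mv /=; case: (v \in T); case: (mu v \in T).
pose h v : bool := e u v || e u' v; pose X := [set w | (w \notin T) && (w != u')].
have hE v : e u v + e u' v = h v.
  have : ~~ (e u v && e u' v).
    by apply/negP => /andP[uv u'v]; have := e_tri euu' u'v; rewrite uv.
  by rewrite /h; case: (e u v); case: (e u' v).
have degs : #|[set w | e u w]| + #|[set w | e u' w]| = \sum_v h v.
  have cE x : #|[set w | e x w]| = \sum_v e x v.
    by rewrite -sum1_card big_mkcond; apply: eq_bigr => v _; rewrite inE; case: (e x v).
  by rewrite !cE -big_split; apply: eq_bigr => v _; apply: hE.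
pose fx := #|[set c in T | (mu c == c) && e c u']|.
(* The matched vertices of [T] are reindexed by their partners outside [T]; the summand [1] comes
   from [u] itself, which is adjacent to [u']. *)
have sumT : fx + 1 + \sum_(w in X) (mu w != w) * h (mu w) <= \sum_(v in T) h v.
  rewrite [X in _ <= X](bigID (fun v => mu v == v)) /= -addnA; apply: leq_add.
    rewrite /fx -sum1_card big_mkcond [X in _ <= X]big_mkcond leq_sum // => v _.
    rewrite inE; case: (v \in T) => //=; case: (mu v == v) => //=.
    by rewrite /h (e_sym v); case: (e u' v); rewrite ?orbT.
  rewrite [X in _ <= X](reindex_inj inj) /=.
  under [X in _ <= X]eq_bigl => v do rewrite inv eq_sym.
  have -> : \sum_(v | (mu v \in T) && (mu v != v)) h (mu v) =
            \sum_(v | (v \notin T) && (mu v != v)) h (mu v).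
    by apply: eq_bigl => v; case: (boolP (mu v != v)) => mv; rewrite ?andbF // muT.
  rewrite [X in _ <= X](bigD1 u') /=; last by rewrite u'T /u' inv eq_sym.
  have -> : h (mu u') = true by rewrite /h /u' inv -/u' (e_sym u') euu' orbT.
  rewrite leq_add2l.
  rewrite big_mkcond [X in _ <= X]big_mkcond leq_sum // => w _; rewrite inE.
  by case: (w \notin T) => //=; case: (w != u'); case: (mu w != w) => //=; rewrite ?mul1n ?mul0n.
have sumC : \sum_(v | v \notin T) h v = 1 + \sum_(w in X) h w.
  rewrite (bigD1 u') //=; have -> : h u' = true by rewrite /h euu'.
  congr (_ + _).
  by apply: eq_bigl => w; rewrite inE.
have cX : #|~: T| = 1 + #|X|.
  rewrite (cardsD1 u') in_setC u'T; congr (_ + _); apply: eq_card => w.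
  by rewrite !inE andbC.
pose t w : bool := [&& mu w != w, h w & h (mu w)].
have sumX : #|X| + \sum_(w in X) t w <= #|supply mu T u| +
    (\sum_(w in X) h w + \sum_(w in X) (mu w != w) * h (mu w)).
  have -> : #|supply mu T u| = \sum_(w in X) [&& ~~ e w u, ~~ e w u' & ~~ e (mu w) u].
    rewrite -sum1_card big_mkcond [RHS]big_mkcond; apply: eq_bigr => w _.
    rewrite !inE -/u'; case: (w \notin T) => //=; case: (w != u') => //=.
  rewrite -sum1_card -!big_split leq_sum // => w _.
  rewrite /t /h !(e_sym w) (e_sym (mu w)); case: (eqVneq (mu w) w) => [->|_] /=;
  by case: (e u w); case: (e u' w); case: (e u (mu w)); case: (e u' (mu w)).
have crossT : #|[set v in T | crossed mu u v]| +
    #|[set v in T :\ u | e u' v && e u (mu v)]| <= \sum_(w in X) t w.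
  have dis : [disjoint [set v in T | crossed mu u v] &
      [set v in T :\ u | e u' v && e u (mu v)]].
    apply/pred0P => v /=; apply/negP; rewrite !inE.
    case/andP=> [/and3P[_ uv _] /and3P[_ u'v _]].
    by have := e_tri euu' u'v; rewrite uv.
  move: dis; rewrite -(leq_card_setU _ _) => /eqP<-.
  rewrite -(card_imset _ inj) -sum1_card big_mkcond [X in _ <= X]big_mkcond leq_sum // => w _.
  case: ifP => // /imsetP[v + ->]; rewrite !inE /t /h !inv => vP.
  have [vT uv adj] : [/\ v \in T, v != u & e u v && e u' (mu v) || e u' v && e u (mu v)].
    case/orP: vP => [/andP[vT c]|/andP[/andP[vu vT] c]]; last by rewrite c orbT.
    have [E|vu] := eqVneq v u; first by move: c; rewrite E /crossed e_irr.
    by rewrite -/(crossed mu u v) c.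
  have mv : mu v != v.
    apply/negP => /eqP fv; rewrite fv in adj.
    have u'v : e u' v by case/orP: adj => /andP[].
    have := e_tri euu' u'v; case/orP: adj => /andP[] => [->|_ ->] //.
  rewrite (inj_eq inj) uv muT // vT eq_sym mv /=.
  by case/orP: adj => /andP[-> ->]; rewrite ?orbT.
move: degs sumT sumC cX sumX crossT; rewrite (bigID (fun v => v \in T)) /= -/fx; clear; lia.
Qed.

Definition crossings mu T := \sum_(x in T) \sum_(y in T) crossed mu x y.

Lemma crossedC mu x y : crossed mu x y = crossed mu y x.
Proof. by rewrite /crossed e_sym (e_sym (mu x)). Qed.

Lemma card_crossed mu T x : \sum_(y in T) crossed mu x y = #|[set y in T | crossed mu x y]|.
Proof.
rewrite -sum1_card big_mkcond [RHS]big_mkcond; apply: eq_bigr => y _.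
by rewrite inE; case: (y \in T); case: (crossed mu x y).
Qed.

Lemma crossingsU1 mu T x : x \notin T ->
  crossings mu (x |: T) = crossings mu T + 2 * #|[set y in T | crossed mu x y]|.
Proof.
move=> xT; rewrite /crossings big_setU1 //= big_setU1 //=.
under [X in _ + X]eq_bigr => y _ do rewrite big_setU1 //= crossedC.
by rewrite big_split /= card_crossed {1}/crossed e_irr; clear; lia.
Qed.

Lemma flip_transversal mu T u : involutive mu -> transversal mu T -> u \in T -> mu u != u ->
  transversal mu (mu u |: T :\ u).
Proof.
move=> inv /forallP tr uT mu_u; apply/forallP => v; apply/implyP => mv.
have inj := inv_inj inv; have := tr v; rewrite mv !inE (inj_eq inj) /=.
have E : (mu v == u) = (v == mu u) by rewrite -(inj_eq inj) inv.
rewrite E; have [->|vu] := eqVneq v u; first by rewrite (eq_sym u) (negPf mu_u).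
by have [->|vu'] := eqVneq v (mu u).
Qed.

(* A transversal minimizing [crossings] works: if no unmatched vertex of [T] is
   [e]-adjacent to [mu u], then exchanging [u] with [mu u] turns the crossed edges
   at [u] into the edges counted by [alt], so there are at least as many of these. *)
Lemma linkage k : (forall v, #|[set w | e v w]| <= k) -> 2 * k <= #|V|./2 + 2 ->
  exists mu T, [/\ matching mu, transversal mu T, unhit mu T, #|T| = uphalf #|V| &
    {in T, forall u, #|[set v in T | crossed mu u v]| <= #|supply mu T u|}].
Proof.
move=> degk k2; have [mu mm [stF nhit]] := maximal_matching.
have [T0 T0P] := transversal_exists mm stF nhit.
pose ok T := [&& transversal mu T, unhit mu T & #|T| == uphalf #|V|].
have [T TP Tmin] := @arg_minnP _ T0 ok (crossings mu) T0P.
have /and3P[tr un /eqP cT] := TP; exists mu, T; split=> // u uT.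
have [inv me] := matchingP _ mm.
have [fu|mu_u] := eqVneq (mu u) u.
  rewrite (_ : [set v in T | _] = set0) ?cards0 //; apply/setP => v; rewrite !inE.
  apply/negP => /and3P[vT uv _].
  by have := forall_inP (forall_inP un u uT) v vT; rewrite fu eqxx uv.
have u'T : mu u \notin T.
  by have /forallP/(_ u) := tr; rewrite mu_u uT /=; case: (_ \in _).
have := supply_count mm tr uT mu_u; set u' := mu u in mu_u u'T *.
set bad := [set v in T | _]; set alt := [set v in T :\ u | _]; set fx := [set c in T | _].
move=> count; have du := degk u; have du' := degk u'.
have cT' : #|T| + #|~: T| = #|V| := cardsC T.
have half : uphalf #|V| + #|V|./2 = #|V|.
  by rewrite uphalf_half -addnA addnn odd_double_half.
(* With the degree bound, the count reads [#|bad| + #|alt| + #|fx| <= #|supply mu T u| + 1]. This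
   suffices at once if [fx] is nonempty; otherwise minimality yields [#|bad| <= #|alt|], which
   suffices too. *)
case: (posnP #|fx|) => [fx0|fx_gt0]; last first.
  move: count du du' cT cT' half k2 fx_gt0; clear; lia.
have badE : bad = [set v in T :\ u | crossed mu u v].
  apply/setP => v; rewrite !inE; have [->|] //= := eqVneq v u.
  by rewrite /crossed e_irr !andbF.
have altE : alt = [set v in T :\ u | crossed mu u' v].
  by apply/setP => v; rewrite !inE /crossed /u' inv.
have flip : crossings mu T <= crossings mu (u' |: T :\ u).
  apply: Tmin; rewrite /ok flip_transversal // cardsU1 !inE (negPf u'T) andbF /=.
  apply/andP; split; last by rewrite add1n -cT (cardsD1 u T) uT.
  apply/forall_inP => c; rewrite !inE => /orP[/eqP->|/andP[cu cT0]].
    by apply/forall_inP => w _; rewrite /u' inv eq_sym (negPf mu_u).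
  apply/forall_inP => w; rewrite !inE => /orP[/eqP->|/andP[_ wT]].
    apply/implyP => fc; apply/negP => cu'.
    by have := cards0_eq fx0 => /setP/(_ c); rewrite !inE cT0 fc cu'.
  by have := forall_inP (forall_inP un c cT0) w wT.
have u'T0 : u' \notin T :\ u by rewrite !inE (negPf u'T) andbF.
have uT0 : u \notin T :\ u by rewrite !inE eqxx.
move: flip; rewrite -[in X in X <= _](setD1K uT) !crossingsU1 // -badE -altE leq_add2l => flip.
move: flip count du du' cT cT' half k2; clear; lia.
Qed.

End Linkage.

(** * Totally odd immersions *)

Section Immersion.

Variable G : sgraph.

Definition coadj : rel G := fun x y => (x != y) && ~~ adj x y.

Lemma coadj_sym : symmetric coadj.
Proof. by move=> x y; rewrite /coadj eq_sym adj_sym. Qed.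

Lemma coadj_irr : irreflexive coadj.
Proof. by move=> x; rewrite /coadj eqxx. Qed.

Lemma adjE x y : x != y -> ~~ coadj x y -> adj x y.
Proof. by rewrite /coadj => ->; rewrite negbK. Qed.

Hypothesis coadj_tri : forall x y z, coadj x y -> coadj y z -> ~~ coadj x z.

Variables (mu : G -> G) (T : {set G}).
Hypotheses (mu_matching : matching coadj mu) (T_transversal : transversal mu T)
  (T_unhit : unhit coadj mu T).

Implicit Types (E : {set G}) (u v w : G) (s : seq G).

Notation crossed := (crossed coadj mu).
Notation supply := (supply coadj mu T).

Let mu_inv : involutive mu. Proof. by case/matchingP: mu_matching. Qed.

Lemma partner u v : u \in T -> v \in T -> coadj u v ->
  [/\ mu u != u, coadj u (mu u) & mu u \notin T].
Proof.
move=> uT vT uv; have mu_u : mu u != u.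
  by apply: contraTneq uv => /eqP fu; have := forall_inP (forall_inP T_unhit u uT) v vT; rewrite fu.
split=> //; first by case/matchingP: mu_matching => _; apply.
by have /forallP/(_ u) := T_transversal; rewrite mu_u uT /=; case: (_ \in _).
Qed.

Definition crossed_pairs : {set {set G}} :=
  [set E | [exists u in T, [exists v in T, (E == [set u; v]) && crossed u v]]].

Lemma crossed_pairsP E : reflect
  (exists u v, [/\ u \in T, v \in T, E = [set u; v] & crossed u v]) (E \in crossed_pairs).
Proof.
rewrite inE; apply: (iffP exists_inP) => [[u uT /exists_inP[v vT /andP[/eqP-> c]]]|].
  by exists u, v.
by case=> u [v [uT vT -> c]]; exists u => //; apply/exists_inP; exists v; rewrite ?eqxx.
Qed.

Hypothesis enough_supply :
  {in T, forall u, #|[set v in T | crossed u v]| <= #|supply u|}.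

(* Hall's condition holds since an edge [mu u; w] between two vertices outside [T]
   is offered at most twice, by [u] and by [mu w], while each crossed pair accepts
   the offers of both its members. *)
Lemma crossed_representatives : exists2 f : {set G} -> {set G},
  {in crossed_pairs &, injective f} &
  {in crossed_pairs, forall E, exists u w, [/\ u \in E, w \in supply u & f E = [set mu u; w]]}.
Proof.
pose r E := [set [set mu u; w] | u in E, w in supply u].
have [|f fi fr] := @hall _ _ set0 r crossed_pairs; last first.
  by exists f => // E /fr /imset2P[u w uE wu ->]; exists u, w.
move=> X /subsetP XB; set N := \bigcup_(E in X) r E.
(* Double counting through ordered pairs: [2 * #|X| <= #|Pr| <= #|Sg| <= 2 * #|N|]. *)
pose Pr := [set p : G * G | [set p.1; p.2] \in X].
pose Sg := [set p : G * G | (p.1 \in cover X) && (p.2 \in supply p.1)].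
have XT u v : [set u; v] \in X -> [/\ u \in T, v \in T & crossed u v].
  move/XB/crossed_pairsP => [u' [v' [u'T v'T E c]]].
  case: (set2_eq E) => -[-> ->]; split=> //.
  by rewrite (crossedC coadj_sym).
have ne u v : crossed u v -> u != v by apply: contraTneq => ->; rewrite /crossed coadj_irr.
have low : 2 * #|X| <= #|Pr|.
  rewrite (@card_fibers _ _ (fun p => [set p.1; p.2]) Pr X); last by move=> p; rewrite inE.
  rewrite mulnC -sum_nat_const; apply: leq_sum => E EX.
  have [u [v [uT vT EE c]]] := crossed_pairsP _ (XB E EX).
  have <- : #|[set (u, v); (v, u)]| = 2.
    by rewrite cards2 xpair_eqE negb_and ne.
  apply: subset_leq_card; apply/subsetP => p; rewrite !inE => /orP[]/eqP-> /=.
    by rewrite -EE EX eqxx.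
  by rewrite setUC -EE EX eqxx.
have mid : #|Pr| <= #|Sg|.
  rewrite (card_pairs (fun u v => [set u; v] \in X)).
  rewrite (card_pairs (fun u w => (u \in cover X) && (w \in supply u))).
  apply: leq_sum => u _; have [uX|uX] := boolP (u \in cover X); last first.
    rewrite (_ : [set v | _] = set0) ?cards0 //; apply/setP => v; rewrite !inE.
    by apply: contraNF uX => vX; apply/bigcupP; exists [set u; v]; rewrite // !inE eqxx.
  rewrite /= (_ : [set w in supply u] = supply u); last by apply/setP => w; rewrite inE.
  have uT : u \in T.
    case/bigcupP: uX => E /XB/crossed_pairsP[x [y [xT yT -> _]]].
    by rewrite !inE => /orP[]/eqP->.
  apply: leq_trans (enough_supply uT); apply: subset_leq_card; apply/subsetP => v.
  by rewrite !inE => /XT[_ -> ->].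
have up : #|Sg| <= 2 * #|N|.
  rewrite (@card_fibers _ _ (fun p => [set mu p.1; p.2]) Sg N); last first.
    move=> p; rewrite inE => /andP[/bigcupP[E EX pE] ps].
    by apply/bigcupP; exists E => //; apply/imset2P; exists p.1 p.2.
  rewrite mulnC -sum_nat_const; apply: leq_sum => E _.
  have [->|/set0Pn[[u w] /setIdP[_ /eqP uw]]] :=
    eqVneq [set p in Sg | [set mu p.1; p.2] == E] set0; first by rewrite cards0.
  apply: leq_trans (_ : #|[set (u, w); (mu w, mu u)]| <= 2); last by rewrite cards2; case: (_ != _).
  apply: subset_leq_card; apply/subsetP => -[u' w']; rewrite inE => /andP[_ /eqP].
  rewrite -uw /= => /set2_eq[[/(inv_inj mu_inv)-> ->]|[<- ->]]; rewrite !inE ?eqxx //.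
  by rewrite mu_inv eqxx orbT.
by move: low mid up; clear; lia.
Qed.

Variable f : {set G} -> {set G}.
Hypotheses (f_inj : {in crossed_pairs &, injective f}).

(** In a [LinkSupply] path the middle edge is [f E], the one reserved for [E] by Hall's theorem. *)
Variant linking (E : {set G}) : seq G -> Prop :=
| LinkEdge u v of u \in T & v \in T & E = [set u; v] & adj u v : linking E [:: u; v]
| LinkPair u v of u \in T & v \in T & E = [set u; v] & coadj u v &
    ~~ coadj (mu u) (mu v) : linking E [:: u; mu v; mu u; v]
| LinkSupply u v w of u \in T & v \in T & E = [set u; v] & crossed u v &
    w \in supply u & f E = [set mu u; w] : linking E [:: u; w; mu u; v].

Lemma linking_exists E u v :
  {in crossed_pairs, forall E, exists u w, [/\ u \in E, w \in supply u & f E = [set mu u; w]]} ->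
  u \in T -> v \in T -> u != v -> E = [set u; v] -> exists s, linking E s.
Proof.
move=> fP uT vT uv EE; have [uv_adj|uv_adj] := boolP (adj u v).
  by exists [:: u; v]; apply: LinkEdge.
have c : coadj u v by rewrite /coadj uv.
have [c'|c'] := boolP (coadj (mu u) (mu v)); last first.
  by exists [:: u; mu v; mu u; v]; apply: LinkPair.
have cuv : crossed u v by rewrite /crossed c.
have [|x [w [xE ws fE]]] := fP E; first by apply/crossed_pairsP; exists u, v.
move: xE; rewrite {1}EE !inE => /orP[]/eqP E'; subst x.
  by exists [:: u; w; mu u; v]; apply: LinkSupply.
exists [:: v; w; mu v; u]; apply: LinkSupply => //; first by rewrite setUC.
by rewrite (crossedC coadj_sym).
Qed.

Lemma supplyP u w : reflect [/\ w \notin T, w != mu u, ~~ coadj w u, ~~ coadj w (mu u) &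
  ~~ coadj (mu w) u] (w \in supply u).
Proof. by rewrite inE; apply: and5P. Qed.

Lemma notin_neq u w : u \in T -> w \notin T -> u != w.
Proof. by move=> uT; apply: contraNneq => <-. Qed.

(** For coadjacent terminals [u] and [v], the edge from [v] to [mu u] is in [G] because [v u] and
    [u (mu u)] are edges of the triangle-free complement; likewise for [u] and [mu v]. *)
Lemma linking_path E s : linking E s ->
  [/\ is_path s, path_ends s = E, odd (path_length s) &
      {in T, forall t, t \notin path_internal s}].
Proof.
case=> [u v uT vT -> uv|u v uT vT -> uv uv'|u v w uT vT -> uv /supplyP[wT wu wu1 wu2 wu3] _].
- split=> //; rewrite /is_path /= uv inE !andbT.
  by apply: contraTneq uv => ->; rewrite adj_irrefl.
- have [nu cu muT] := partner uT vT uv.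
  have vu : coadj v u by rewrite coadj_sym.
  have [nv cv mvT] := partner vT uT vu.
  have uv_ne : u != v by apply: contraTneq uv => ->; rewrite coadj_irr.
  have mne : mu v != mu u by rewrite (inj_eq (inv_inj mu_inv)) eq_sym.
  split=> //; last first.
    move=> t tT; rewrite /= !inE negb_or.
    by rewrite (notin_neq tT mvT) (notin_neq tT muT).
  rewrite /is_path /= !inE !negb_or mne uv_ne !(notin_neq uT) // (eq_sym _ v) (eq_sym _ v).
  rewrite !(notin_neq vT) // !andbT.
  apply/and3P; split; apply: adjE; rewrite ?(notin_neq uT) //.
  + exact: coadj_tri uv cv.
  + by rewrite coadj_sym.
  + by rewrite eq_sym (notin_neq vT).
  + by rewrite coadj_sym; apply: coadj_tri vu cu.
- have [c _] := andP uv; have [nu cu muT] := partner uT vT c.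
  have uv_ne : u != v by apply: contraTneq c => ->; rewrite coadj_irr.
  have vu : coadj v u by rewrite coadj_sym.
  split=> //; last first.
    by move=> t tT; rewrite /= !inE negb_or (notin_neq tT wT) (notin_neq tT muT).
  rewrite /is_path /= !inE !negb_or wu uv_ne !(notin_neq uT) // (eq_sym _ v) (eq_sym _ v).
  rewrite !(notin_neq vT) // !andbT.
  apply/and3P; split; apply: adjE; rewrite ?(notin_neq uT) //.
  + by rewrite coadj_sym.
  + by rewrite eq_sym (notin_neq vT).
  + by rewrite coadj_sym; apply: coadj_tri vu cu.
Qed.

(* The pair [E] whose linking path runs through the edge [A] can be read off [A]. *)
Variant owner (A E : {set G}) : Prop :=
| OwnTT of A \subset T & E = A
| OwnTN t z of t \in T & z \notin T & A = [set t; z] & coadj t (mu z) & E = [set t; mu z]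
| OwnTNf t z of t \in T & z \notin T & A = [set t; z] & ~~ coadj t (mu z) &
    E \in crossed_pairs & f E = [set mu t; z]
| OwnNN y z of y \notin T & z \notin T & A = [set y; z] & coadj (mu y) (mu z) &
    E = [set mu y; mu z]
| OwnNNf y z of y \notin T & z \notin T & A = [set y; z] & ~~ coadj (mu y) (mu z) &
    E \in crossed_pairs & f E = A.

(** The number of ends of [A] in [T], and coadjacency after moving the ends outside [T] to their
    partners, tell the five cases apart. [E] is then explicit, or determined by [f E] through
    injectivity. *)
Lemma owner_inj A E E' : owner A E -> owner A E' -> E = E'.
Proof.
have TT t z : [set t; z] \subset T -> z \notin T -> False.
  by move=> /subsetP/(_ z); rewrite !inE eqxx orbT => /(_ isT) ->.
have TN t z t' z' : t \in T -> z \notin T -> z' \notin T -> [set t; z] = [set t'; z'] ->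
    t = t' /\ z = z'.
  by move=> tT zT z'T /set2_eq[//|[E1 _]]; rewrite E1 (negPf z'T) in tT.
have TNN t z y z' : t \in T -> y \notin T -> z' \notin T -> [set t; z] = [set y; z'] -> False.
  by move=> tT yT z'T /set2_eq[[E1 _]|[E1 _]]; move: tT; rewrite E1 ?(negPf yT) ?(negPf z'T).
case=> [AT ->|t z tT zT AE c ->|t z tT zT AE c Ec fE|y z yT zT AE c ->|y z yT zT AE c Ec fE];
  case=> [A'T ->|t' z' t'T z'T AE' c' ->|t' z' t'T z'T AE' c' Ec' fE'|y' z' y'T z'T AE' c' ->
    |y' z' y'T z'T AE' c' Ec' fE'] //;
  try (exfalso; first [by rewrite AE' in AT; apply: TT AT z'T | by rewrite AE in A'T; apply: TT A'T zT]);
  rewrite AE in AE'; try (exfalso; first [by apply: TNN AE' | by apply: TNN (esym AE')]).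
- by have [<- <-] := TN _ _ _ _ tT zT z'T AE'.
- by have [E1 E2] := TN _ _ _ _ tT zT z'T AE'; rewrite -E1 -E2 c in c'.
- by have [E1 E2] := TN _ _ _ _ tT zT z'T AE'; rewrite -E1 -E2 (negPf c) in c'.
- have [E1 E2] := TN _ _ _ _ tT zT z'T AE'; apply: f_inj => //.
  by rewrite fE fE' E1 E2.
- by case: (set2_eq AE') => -[<- <-] //; rewrite setUC.
- by case: (set2_eq AE') => -[E1 E2]; move: c'; rewrite -E1 -E2 ?(coadj_sym (mu z)) c.
- by case: (set2_eq AE') => -[E1 E2]; move: c'; rewrite -E1 -E2 ?(coadj_sym (mu z)) (negPf c).
- by apply: f_inj => //; rewrite fE fE'.
Qed.

Lemma linking_owner E s A : linking E s -> A \in path_edges s -> owner A E.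
Proof.
case=> [u v uT vT -> uv|u v uT vT -> uv uv'|u v w uT vT EE uv ws fE] /imsetP[p + ->].
- rewrite /= inE => /eqP->; apply: OwnTT => //.
  by apply/subsetP => x; rewrite !inE => /orP[]/eqP->.
- have [nu cu muT] := partner uT vT uv.
  have vu : coadj v u by rewrite coadj_sym.
  have [nv cv mvT] := partner vT uT vu.
  rewrite /= !inE => /or3P[]/eqP-> /=.
  + by apply: (@OwnTN _ _ u (mu v)); rewrite ?mu_inv.
  + by apply: (@OwnNN _ _ (mu v) (mu u)); rewrite ?mu_inv // setUC.
  + by apply: (@OwnTN _ _ v (mu u)); rewrite ?mu_inv // setUC.
- have Ec : E \in crossed_pairs by apply/crossed_pairsP; exists u, v.
  have [c _] := andP uv; have [nu cu muT] := partner uT vT c.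
  have vu : coadj v u by rewrite coadj_sym.
  have [wT wu wu1 wu2 wu3] := supplyP _ _ ws.
  rewrite /= !inE => /or3P[]/eqP-> /=.
  + by apply: (@OwnTNf _ _ u w); rewrite // coadj_sym.
  + by apply: (@OwnNNf _ _ w (mu u)); rewrite ?mu_inv // setUC.
  + by apply: (@OwnTN _ _ v (mu u)); rewrite ?mu_inv // setUC.
Qed.

Lemma linking_disjoint E E' s s' : linking E s -> linking E' s' -> E != E' ->
  [disjoint path_edges s & path_edges s'].
Proof.
move=> ls ls' EE'; apply/pred0P => A /=; apply/negP => /andP[As As'].
by have := owner_inj (linking_owner ls As) (linking_owner ls' As') => E1; rewrite E1 eqxx in EE'.
Qed.

Lemma immersion_of_representatives m :
  {in crossed_pairs, forall E, exists u w, [/\ u \in E, w \in supply u & f E = [set mu u; w]]} ->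
  #|T| = m -> has_totally_odd_immersion (complete m) G.
Proof.
move=> fP <-; pose phi (i : complete #|T|) : G := enum_val (i : 'I_#|T|).
have phi_inj : injective phi by apply: enum_val_inj.
have phiT i : phi i \in T by apply: enum_valP.
have pairs A : A \in edges (complete #|T|) ->
    exists u v, [/\ u \in T, v \in T, u != v & phi @: A = [set u; v]].
  rewrite inE => /existsP[i /existsP[j /andP[ij /eqP->]]].
  exists (phi i), (phi j); split=> //; first by rewrite (inj_eq phi_inj).
  by rewrite imsetU1 imset_set1.
have [Q QP] : exists Q : {set complete #|T|} -> seq G,
    forall A, A \in edges (complete #|T|) -> linking (phi @: A) (Q A).
  apply: (@fin_all_exists _ _ (fun A s => A \in edges (complete #|T|) -> linking (phi @: A) s)) => A.
  have [AE|AE] := boolP (A \in edges (complete #|T|)); last by exists [::].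
  have [u [v [uT vT uv AE']]] := pairs A AE.
  by have [s ls] := linking_exists fP uT vT uv AE'; exists s.
exists phi, Q; split.
  split=> // [A AE|A B AE BE AB|A AE i].
  - by have [] := linking_path (QP A AE).
  - apply: linking_disjoint (QP A AE) (QP B BE) _.
    by apply: contra_neq AB; apply: imset_inj.
  - by have [_ _ _ notT] := linking_path (QP A AE); apply: notT.
by move=> A AE; have [_ _] := linking_path (QP A AE).
Qed.

End Immersion.

Lemma totally_odd_immersion (G : sgraph) k :
  (forall x y z : G, coadj x y -> coadj y z -> ~~ coadj x z) ->
  (forall v : G, #|[set w | coadj v w]| <= k) -> 2 * k <= #|G|./2 + 2 ->
  has_totally_odd_immersion (complete (uphalf #|G|)) G.
Proof.
move=> tri degk k2.
have [mu [T [mm tr un cT supp]]] := linkage (@coadj_sym G) (@coadj_irr G) tri degk k2.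
have [f fi fP] := crossed_representatives mm supp.
exact: (immersion_of_representatives tri mm tr un fi fP cT).
Qed.

(** * Odd minors *)

Section OddMinor.

Variable G : sgraph.

Implicit Types (x y b c v : G) (A B : {set G}).

Definition star_edges c B : {set {set G}} := [set [set c; v] | v in B :\ c].

Lemma star_edges_edges c B : {in B, forall v, v != c -> adj c v} -> star_edges c B \subset edges G.
Proof.
move=> cB; apply/subsetP => _ /imsetP[v /setD1P[vc vB] ->]; rewrite inE.
by apply/existsP; exists c; apply/existsP; exists v; rewrite cB ?eqxx.
Qed.

Lemma star_edges_vertices c B : c \in B -> star_edges c B \subset powerset B.
Proof.
move=> cB; apply/subsetP => _ /imsetP[v /setD1P[_ vB] ->]; rewrite inE.
by apply/subsetP => x; rewrite !inE => /orP[]/eqP->.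
Qed.

Lemma star_exists c B : c \in B -> {in B, forall v, v != c -> adj c v} ->
  exists T : subgraph G, [/\ sub_vertices T = B, is_tree T &
    forall x y, sub_adj T x y -> x != y /\ (x = c /\ y \in B \/ y = c /\ x \in B)].
Proof.
move=> cB adjB.
pose T := Subgraph (star_edges_edges adjB) (star_edges_vertices cB); exists T.
have adjT x y : sub_adj T x y -> x != y /\ (x = c /\ y \in B \/ y = c /\ x \in B).
  case/imsetP => v /setD1P[vc vB] /set2_eq[] [-> ->]; split; auto.
  by rewrite eq_sym.
have adjc v : v \in B -> v != c -> sub_adj T c v && sub_adj T v c.
  move=> vB vc; rewrite /sub_adj (setUC [set v]) andbb.
  by apply/imsetP; exists v; rewrite // !inE vc.
split=> //; split.
- by apply/set0Pn; exists c.
- have cv v : v \in B -> connect (sub_adj T) c v /\ connect (sub_adj T) v c.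
    move=> vB; have [->|vc] := eqVneq v c; first by rewrite connect0.
    by have /andP[? ?] := adjc v vB vc; split; apply: connect1.
  by move=> x y /cv[_ xc] /cv[cy _]; apply: connect_trans xc cy.
(* Every edge contains the centre. On a cycle with at least three vertices, either [y z] or the
   closing edge would have to contain a second copy of it. *)
- case=> [|x [|y [|z s]]] // _ /andP[/= /and3P[xy yz pz] /and3P[]].
  rewrite !inE !negb_or => /and3P[xny xnz xs] /andP[ynz ys] _.
  have [_ [[xc _]|[yc _]]] := adjT _ _ xy.
    have [_ [[yc _]|[zc _]]] := adjT _ _ yz.
      by rewrite xc yc eqxx in xny.
    by rewrite xc zc eqxx in xnz.
  move: pz; rewrite rcons_path => /andP[_ lx].
  have [_ [[lc _]|[xc _]]] := adjT _ _ lx; last by rewrite xc yc eqxx in xny.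
  have := mem_last z s; rewrite lc -yc inE (negPf ynz) /=.
  by rewrite (negPf ys).
Qed.

Lemma odd_minor_of_stars (F : {set {set G}}) (c : {set G} -> G) (col : G -> bool) :
  trivIset F -> {in F, forall B, c B \in B} ->
  {in F, forall B, {in B, forall v, v != c B -> adj (c B) v /\ col v != col (c B)}} ->
  {in F &, forall A B, A != B -> exists x y, [/\ x \in A, y \in B, adj x y & col x = col y]} ->
  has_odd_clique_minor G #|F|.
Proof.
move=> triv cF adjF link.
pose br (i : 'I_#|F|) := enum_val i.
have brF i : br i \in F by apply: enum_valP.
have [T TP] : exists T : 'I_#|F| -> subgraph G, forall i,
    [/\ sub_vertices (T i) = br i, is_tree (T i) & forall x y, sub_adj (T i) x y ->
      x != y /\ (x = c (br i) /\ y \in br i \/ y = c (br i) /\ x \in br i)].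
  apply: (@fin_all_exists _ _ (fun i (T : subgraph G) => [/\ sub_vertices T = br i, is_tree T &
    forall x y, sub_adj T x y ->
      x != y /\ (x = c (br i) /\ y \in br i \/ y = c (br i) /\ x \in br i)])) => i.
  apply: star_exists; first exact: cF.
  by move=> v vB vc; have [] := adjF _ (brF i) v vB vc.
have brn i j : i != j -> br i != br j by rewrite (inj_eq enum_val_inj).
exists T, col; split.
- by move=> i; have [] := TP i.
- move=> i j ij; have [-> _ _] := TP i; have [-> _ _] := TP j.
  exact: (trivIsetP triv) (brF i) (brF j) (brn _ _ ij).
- move=> i x y xy; have [_ _ /(_ x y xy)[xny]] := TP i.
  case=> -[E vB]; rewrite E in xny *.
    by rewrite eq_sym; rewrite eq_sym in xny; have [] := adjF _ (brF i) _ vB xny.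
  by have [] := adjF _ (brF i) _ vB xny.
- move=> i j ij; have [-> _ _] := TP i; have [-> _ _] := TP j.
  by apply: link; rewrite ?brF // brn // neq_ltn ij.
Qed.

End OddMinor.

(** * The odd minor given by a clique and disjoint seagulls *)

Section Dichotomy.

Variable G : sgraph.
Hypothesis tri : forall x y z : G, coadj x y -> coadj y z -> ~~ coadj x z.

Implicit Types (K A B P Q : {set G}) (x y b v : G).

Local Notation seagull := (seagull (@coadj G)).
Local Notation packing := (packing (@coadj G)).
Local Notation stable := (stable (@coadj G)).

Let uniq_seagull x y b : seagull x y b -> uniq [:: x; y; b] :=
  @seagull_uniq _ _ (@coadj_sym G) (@coadj_irr G) x y b.

(** The branch sets are the singletons of [K] and the seagulls; the colour singles out the middle
    vertices of the seagulls. The ends of a seagull are nonadjacent in [G], so any other vertex is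
    adjacent to one of them, and vertices that are not middles provide all the monochromatic
    edges. *)
Lemma odd_minor_of_seagulls (x0 : G) K (F : {set {set G}}) :
  stable K -> packing (~: K) F -> has_odd_clique_minor G (#|K| + #|F|).
Proof.
move=> stK pF; have [triv cov sF] := pF.
have FK B v : B \in F -> v \in B -> v \notin K.
  move=> BF vB; rewrite -in_setC; apply: (subsetP cov).
  by apply/bigcupP; exists B.
(* The second clause lets one function [c] also serve the singletons; [x0] is the value at sets of
   neither kind. *)
pose center_spec B c := (B \in F -> exists x y, B = [set x; y; c] /\ seagull x y c) /\
  (B \notin F -> forall v, B = [set v] -> c = v).
have [c cP] : exists c, forall B, center_spec B (c B).
  apply: (@fin_all_exists _ _ center_spec) => B.
  have [BF|BF] := boolP (B \in F).
    by have [x [y [b [BE sg]]]] := sF B BF; exists b; split; [exists x, y | rewrite BF].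
  have [/cards1P[v E]|B1] := boolP (#|B| == 1).
    by exists v; split=> [|_ w]; rewrite ?(negPf BF) // E => /set1_inj.
  exists x0; split=> [|_ v E]; first by rewrite (negPf BF).
  by rewrite E cards1 in B1.
pose S1 := [set [set v] | v in K].
have S1F A : A \in S1 -> A \notin F.
  by case/imsetP => v vK ->; apply: contraL vK => /FK; apply; rewrite inE.
have cS1 v : v \in K -> c [set v] = v.
  by move=> vK; have [_ h] := cP [set v]; apply: h => //; apply/S1F/imset_f.
have cF B : B \in F -> exists x y, B = [set x; y; c B] /\ seagull x y (c B) by case: (cP B).
have -> : #|K| + #|F| = #|S1 :|: F|.
  have dis : [disjoint S1 & F].
    by apply/pred0P => A /=; apply/negP => /andP[/S1F/negPf->].
  by move: dis; rewrite -(leq_card_setU S1 F) card_imset => [/eqP|] //; apply: set1_inj.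
have triv' : trivIset (S1 :|: F).
  apply/trivIsetP => A B; rewrite !in_setU.
  case/orP=> [/imsetP[v vK ->]|AF] /orP[/imsetP[w wK ->]|BF] AB.
  - by rewrite disjoints1 inE; apply: contra AB => /eqP->.
  - by rewrite disjoints1; apply: contraL vK => /(FK _ _ BF).
  - by rewrite disjoint_sym disjoints1; apply: contraL wK => /(FK _ _ AF).
  - exact: (trivIsetP triv).
pose col v := [exists B in F, v == c B].
have cB B : B \in F -> c B \in B.
  move=> BF; have [x [y [BE _]]] := cF B BF.
  have : c B \in [set x; y; c B] by rewrite !inE eqxx orbT.
  by rewrite -BE.
have colK v : v \in K -> col v = false.
  move=> vK; apply/negbTE/exists_inP => -[B BF /eqP E].
  have vB : v \in B by rewrite E cB.
  by have := FK B v BF vB; rewrite vK.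
have colF B v : B \in F -> v \in B -> col v = (v == c B).
  move=> BF vB; apply/exists_inP/eqP => [[A AF /eqP E]|E]; last by exists B; rewrite // E.
  have [<- //|AB] := eqVneq A B.
  have /pred0P/(_ v) := trivIsetP triv _ _ AF BF AB.
  by rewrite /= vB E cB.
have white B : B \in F -> exists x y, [/\ x \in B, y \in B, coadj x y, col x = false & col y = false].
  move=> BF; have [x [y [BE sg]]] := cF B BF; exists x, y.
  have [xB yB] : x \in B /\ y \in B by rewrite BE !inE !eqxx orbT.
  have [xy _ _] := and3P sg; have := uniq_seagull sg.
  rewrite /= !inE negb_or andbT => /andP[/andP[_ xc] yc].
  by rewrite !(colF B) // (negPf xc) (negPf yc).
have reach v x y : coadj x y -> v != x -> v != y -> adj v x \/ adj v y.
  move=> xy vx vy; have [vx'|vx'] := boolP (coadj v x); last by left; apply: adjE.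
  by right; apply: adjE => //; apply: tri vx' xy.
have someF A B x : B \in F -> A \in S1 :|: F -> A != B -> x \in A -> col x = false ->
    exists2 y, y \in B & adj x y /\ col y = false.
  move=> BF AF AB xA cx; have [y [z [yB zB yz cy cz]]] := white B BF.
  have xB : x \notin B.
    have BF' : B \in S1 :|: F by rewrite in_setU BF orbT.
    by have /pred0P/(_ x) := trivIsetP triv' A B AF BF' AB; rewrite /= xA => /= ->.
  have ne w : w \in B -> x != w by move=> wB; apply: contraNneq xB => ->.
  by case: (reach x y z yz (ne y yB) (ne z zB)) => xw; [exists y | exists z].
apply: (@odd_minor_of_stars _ _ c col) => // [B|B|A B].
- by rewrite in_setU => /orP[/imsetP[v vK ->]|/cB //]; rewrite cS1 // inE.
- rewrite in_setU => /orP[/imsetP[v vK ->] w|BF v vB vc].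
    by rewrite inE cS1 // => /eqP->; rewrite eqxx.
  rewrite !(colF B) ?cB // eqxx (negPf vc); split=> //.
  have [x [y [BE sg]]] := cF B BF; have [_ xc yc] := and3P sg.
  apply: adjE; first by rewrite eq_sym.
  have : v \in [set x; y; c B] by rewrite -BE.
  by rewrite !inE (negPf vc) orbF coadj_sym => /orP[]/eqP->.
move=> AF BF AB; have BA : B != A by rewrite eq_sym.
move: (AF) (BF); rewrite !in_setU.
have [BF'|BF'] := boolP (B \in F) => [_ _|].
  have [x xA cx] : exists2 x, x \in A & col x = false.
    move: AF; rewrite in_setU => /orP[/imsetP[v vK ->]|AF0].
      by exists v; rewrite ?inE // colK.
    by have [x [? [xA _ _ cx _]]] := white A AF0; exists x.
  have [y yB [xy cy]] := someF A B x BF' AF AB xA cx.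
  by exists x, y; rewrite cx cy.
rewrite orbF => + /imsetP[w wK BE].
have [AF' _|AF'] := boolP (A \in F).
  have wB : w \in B by rewrite BE inE.
  have [y yA [wy cy]] := someF B A w AF' BF BA wB (colK w wK).
  by exists y, w; rewrite cy colK // adj_sym.
rewrite orbF => /imsetP[v vK AE]; exists v, w.
rewrite AE BE !inE !colK //; split=> //; apply: adjE; last exact: stK.
by apply: contraNneq AB => E; rewrite AE BE E.
Qed.

Definition is_stable A := [forall x in A, forall y in A, ~~ coadj x y].

Lemma is_stableP A : reflect (stable A) (is_stable A).
Proof.
apply: (iffP forall_inP) => [h x y xA yA|h x xA]; first exact: (forall_inP (h x xA)).
by apply/forall_inP => y yA; apply: h.
Qed.

Lemma stableU P A : stable P -> stable A -> {in P & A, forall p v, ~~ coadj p v} -> stable (P :|: A).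
Proof.
move=> stP stA PA x y; rewrite !in_setU => /orP[xP|xA] /orP[yP|yA].
- exact: stP.
- exact: PA.
- by rewrite coadj_sym; apply: PA.
- exact: stA.
Qed.

(** A vertex of [K] outside [K1] is coadjacent to some vertex of [P], hence to none of [Q]. So
    [P :|: K1] and [Q :|: K :\: K1] are both cliques of [G], and adding their sizes gives
    [#|P| + #|Q| <= #|K|]. *)
Lemma maximum_clique_thin K s : stable K -> (forall A, stable A -> #|A| <= #|K|) ->
  2 * (#|K| + s) <= #|G| + 1 -> thin (@coadj G) (~: K) s.
Proof.
move=> stK maxK ks P Q PK QK stP stQ jPQ.
pose K1 := [set v in K | [forall p in P, ~~ coadj p v]].
have subK A : A \subset K -> stable A.
  by move=> /subsetP AK x y xA yA; apply: stK; apply: AK.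
have K1K : K1 \subset K by apply/subsetP => v; rewrite inE => /andP[].
have st1 : stable (P :|: K1).
  apply: stableU => // [|p v pP]; first exact: subK.
  by rewrite inE => /andP[_ /forall_inP]; apply.
have st2 : stable (Q :|: K :\: K1).
  apply: stableU => // [|q v qQ]; first by apply: subK; apply: subsetDl.
  rewrite !inE negb_and => /andP[+ vK'].
  case/orP=> [vK|/forall_inPn[p pP /negPn pv]].
    by rewrite vK' in vK.
  by rewrite coadj_sym; apply: (@tri v p); [rewrite coadj_sym | exact: jPQ].
have cU A B : A \subset ~: K -> B \subset K -> #|A :|: B| = #|A| + #|B|.
  move=> /subsetP AK /subsetP BK; apply/eqP; rewrite (leq_card_setU A B).
  by apply/pred0P => v /=; apply/negP => /andP[/AK + /BK]; rewrite inE => /negPf->.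
have := maxK _ st1; have := maxK _ st2; rewrite !cU ?subsetDl //.
have := cardsID K1 K; rewrite (setIidPr K1K); have := cardsC K.
by move: ks; clear; lia.
Qed.

End Dichotomy.

(** * The case distinction on the size of a maximum clique *)

Lemma coadj_triangle_free (G : sgraph) : alpha G <= 2 ->
  forall x y z : G, coadj x y -> coadj y z -> ~~ coadj x z.
Proof.
move=> a2 x y z /andP[xy xy'] /andP[yz yz']; apply/negP => /andP[xz xz'].
have ind : independent [set x; y; z].
  apply/forall_inP => u uS; apply/forall_inP => v vS; move: uS vS; rewrite !inE -!orbA.
  by case/or3P => /eqP-> /or3P[]/eqP->; rewrite ?adj_irrefl // adj_sym.
have := leq_trans (leq_bigmax_cond _ ind) a2.
by rewrite -setUA cardsU1 !inE cards2 negb_or xy xz yz.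
Qed.

Theorem theorem1p4 (G : sgraph) (alphaG : alpha G = 2) :
  has_odd_clique_minor G (uphalf #|G|) \/
  has_totally_odd_immersion (complete (uphalf #|G|)) G.
Proof.
have tri : forall x y z : G, coadj x y -> coadj y z -> ~~ coadj x z.
  by apply: coadj_triangle_free; rewrite alphaG.
(* The empty graph has independence number 0; otherwise [x0] serves as a default vertex. *)
have [x0|G0] := pickP (mem G); last first.
  suff : alpha G = 0 by rewrite alphaG.
  apply: big1 => A _; apply/eqP; rewrite cards_eq0; apply/eqP/setP => x.
  by have := G0 x.
move=> _; have st0 : is_stable (set0 : {set G}) by apply/forall_inP => x; rewrite inE.
have [K /is_stableP stK maxK'] := arg_maxnP (fun A : {set G} => #|A|) st0.
have maxK A : stable (@coadj G) A -> #|A| <= #|K| by move=> /is_stableP; apply: maxK'.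
have half : uphalf #|G| = #|G|./2 + odd #|G| by rewrite uphalf_half addnC.
have cG := odd_double_half #|G|.
case: (leqP (uphalf #|G|) #|K|) => [mK|Km].
  left; have [K' K'K <-] := subset_of_card mK; rewrite -[#|K'|]addn0 -(cards0 {set G}).
  apply: odd_minor_of_seagulls => //; last exact: packing0.
  by move=> x y xK yK; apply: stK; apply: (subsetP K'K).
pose s := uphalf #|G| - #|K|.
have ks : #|K| + s = uphalf #|G| by rewrite subnKC // ltnW.
have cKC := cardsC K.
have [big|small] := ltnP (3 * s) #|~: K|.
  left; have th : thin (@coadj G) (~: K) s.
    apply: maximum_clique_thin => //; rewrite ks; move: half cG; clear; lia.
  have [F pF cF] := thin_has_seagulls (@coadj_sym G) (@coadj_irr G) tri big th.
  by rewrite -ks -cF; apply: odd_minor_of_seagulls.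
(* Neighbourhoods in the complement are cliques of [G], so degrees there are at most [#|K|]. From
   [#|~: K| <= 3 * s] follows [2 * #|K| <= 3 * uphalf #|G| - #|G|], which is at most [#|G|./2 + 2],
   with equality for odd [#|G|]. *)
right; apply: (@totally_odd_immersion _ #|K|) => //.
  move=> v; apply: maxK => x y; rewrite !inE => vx vy.
  by apply: tri _ vy; rewrite coadj_sym.
move: small ks cKC half cG; clear; lia.
Qed.
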